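(* Let $B\equiv B(t;y,a,b)$ be the unique formal power series in $t$ solution of $$B=t\left(1+y\frac{abB^2}{1-abB^2}\right)^2(1+aB)(1+bB).$$ Then $$P(t,y,a,b;1)=B-\frac{yabB^3(1+aB)(1+bB)}{(1-abB^2)^2}.$$
   Context: A cell is a unit square rotated by 45 degrees; its four edges are called its left upper, left lower, right upper and right lower edges. Cells are glued edge to edge; an edge of a cell is free if it is not glued to an edge of another cell. A fighting fish is a collection of cells glued along edges that can be obtained from a single initial cell (the head) by repeatedly applying one of the following operations: (i) if a cell $a$ has a free right upper edge, glue the left lower edge of a new cell to it; (ii) if a cell $a$ has a free right lower edge, glue the left upper edge of a new cell to it; (iii) if cells $a,b,c$ are such that the left lower edge of $b$ is glued to the right upper edge of $a$, the left upper edge of $c$ is glued to the right lower edge of $a$, and the right lower edge of $b$ and the right upper edge of $c$ are free, glue simultaneously the left upper edge of a new cell $d$ to the right lower edge of $b$ and the left lower edge of $d$ to the right upper edge of $c$. A fighting fish is the resulting glued object, independent of the order of construction (cells need not fit in the plane). The head is the unique cell with both left edges free; the nose is its leftmost point. A tail is the rightmost point of a cell whose two right edges are free. The fin is the boundary path that starts at the nose, follows the boundary counterclockwise (along free lower edges), and ends at the first tail reached; the fin length is its number of edges. The size (resp. left size, right size) of a fish is its number of free lower edges (resp. free left lower edges, free right lower edges). Define the formal power series $P(t,y,a,b;u)=\sum_{P} t^{\mathrm{size}(P)-1}y^{\mathrm{tails}(P)-1}a^{\mathrm{rsize}(P)-1}b^{\mathrm{lsize}(P)-1}u^{\mathrm{fin}(P)-1}$,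 summed over all fighting fish, where tails is the number of tails, rsize the right size, lsize the left size, fin the fin length. *)

(* Defs.v *)
From HB Require Import structures.
From mathcomp Require Import all_boot all_order all_algebra.
Set Implicit Arguments. Unset Strict Implicit. Unset Printing Implicit Defensive.
Import Order.TTheory GRing.Theory Num.Theory.
Local Open Scope ring_scope.

(* A series is its coefficient function: f n1 n2 n3 n4 is the coefficient *)
(* of t^n1 y^n2 a^n3 b^n4.                                                *)
Definition fps := nat -> nat -> nat -> nat -> rat.

Definition fconst (c : rat) : fps := fun i j k l =>
  if [&& i == 0%N, j == 0%N, k == 0%N & l == 0%N] then c else 0.
Definition fone : fps := fconst 1.
Definition fadd (f g : fps) : fps := fun i j k l => f i j k l + g i j k l.
Definition fopp (f : fps) : fps := fun i j k l => - f i j k l.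
Definition fsub (f g : fps) : fps := fadd f (fopp g).
Definition fscale (c : rat) (f : fps) : fps := fun i j k l => c * f i j k l.
Definition fmul (f g : fps) : fps := fun n1 n2 n3 n4 =>
  \sum_(i1 < n1.+1) \sum_(i2 < n2.+1) \sum_(i3 < n3.+1) \sum_(i4 < n4.+1)
     f i1 i2 i3 i4 * g (n1 - i1)%N (n2 - i2)%N (n3 - i3)%N (n4 - i4)%N.
Fixpoint fpow (f : fps) (k : nat) : fps :=
  match k with 0%N => fone | k'.+1 => fmul f (fpow f k') end.

Definition ft : fps := fun i j k l => if [&& i == 1%N, j == 0%N, k == 0%N & l == 0%N] then 1 else 0.
Definition fy : fps := fun i j k l => if [&& i == 0%N, j == 1%N, k == 0%N & l == 0%N] then 1 else 0.
Definition fa : fps := fun i j k l => if [&& i == 0%N, j == 0%N, k == 1%N & l == 0%N] then 1 else 0.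
Definition fb : fps := fun i j k l => if [&& i == 0%N, j == 0%N, k == 0%N & l == 1%N] then 1 else 0.

(* Multiplicative inverse of a series with nonzero constant term c:
   f^{-1} = c^{-1} * sum_k X^k with X = 1 - c^{-1} f (X has zero constant
   term, so only k <= total degree contributes to a given coefficient). *)
Definition finv (f : fps) : fps :=
  let c := f 0%N 0%N 0%N 0%N in
  let X := fsub fone (fscale c^-1 f) in
  fscale c^-1 (fun n1 n2 n3 n4 =>
     \sum_(k < (n1 + n2 + n3 + n4).+1) fpow X k n1 n2 n3 n4).
Definition fdiv (f g : fps) : fps := fmul f (finv g).

Definition B_equation (B : fps) : Prop :=
  let abB2 := fmul (fmul fa fb) (fpow B 2) in
  B = fmul (fmul (fmul ft
          (fpow (fadd fone (fmul fy (fdiv abB2 (fsub fone abB2)))) 2))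
          (fadd fone (fmul fa B)))
        (fadd fone (fmul fb B)).

Definition P_formula (B : fps) : fps :=
  let abB2 := fmul (fmul fa fb) (fpow B 2) in
  fsub B (fdiv (fmul (fmul (fmul (fmul (fmul fy fa) fb) (fpow B 3))
                       (fadd fone (fmul fa B))) (fadd fone (fmul fb B)))
               (fpow (fsub fone abB2) 2)).

(* Fighting fish.                                                          *)
(* A (pre)fish has cells 0 .. ncells-1 (cell 0 is the head).               *)
(*   ru x = Some y : the right upper edge of x is glued to the left lower  *)
(*                   edge of y;                                            *)
(*   rl x = Some y : the right lower edge of x is glued to the left upper  *)
(*                   edge of y.                                            *)
(* These are the only gluings produced by operations (i)-(iii).            *)
Record prefish := PreFish {
  ncells : nat;
  ru : nat -> option nat;
  rl : nat -> option nat }.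

Definition upd (f : nat -> option nat) (x : nat) (v : option nat) :=
  fun z => if z == x then v else f z.

Definition head_fish : prefish := PreFish 1 (fun _ => None) (fun _ => None).

Inductive is_fish : prefish -> Prop :=
| fish_head : is_fish head_fish
| fish_op1 F x : is_fish F -> (x < ncells F)%N -> ru F x = None ->
    is_fish (PreFish (ncells F).+1 (upd (ru F) x (Some (ncells F))) (rl F))
| fish_op2 F x : is_fish F -> (x < ncells F)%N -> rl F x = None ->
    is_fish (PreFish (ncells F).+1 (ru F) (upd (rl F) x (Some (ncells F))))
| fish_op3 F x y z : is_fish F -> (x < ncells F)%N ->
    ru F x = Some y -> rl F x = Some z -> rl F y = None -> ru F z = None ->
    is_fish (PreFish (ncells F).+1 (upd (ru F) z (Some (ncells F)))
                                   (upd (rl F) y (Some (ncells F)))).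

Definition fish_iso (F G : prefish) : Prop :=
  exists f g : nat -> nat,
    (forall i, (i < ncells F)%N -> (f i < ncells G)%N /\ g (f i) = i) /\
    (forall j, (j < ncells G)%N -> (g j < ncells F)%N /\ f (g j) = j) /\
    (forall i, (i < ncells F)%N ->
        ru G (f i) = omap f (ru F i) /\ rl G (f i) = omap f (rl F i)).

Definition cells (F : prefish) := iota 0 (ncells F).
Definition tails (F : prefish) : nat :=
  count (fun i => (ru F i == None) && (rl F i == None)) (cells F).
Definition rsize (F : prefish) : nat :=           (* free right lower edges *)
  count (fun i => rl F i == None) (cells F).
Definition lsize (F : prefish) : nat :=           (* free left lower edges *)
  count (fun i => ~~ has (fun j => ru F j == Some i) (cells F)) (cells F).
Definition fsize (F : prefish) : nat := (rsize F + lsize F)%N.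

Definition fish_number_is (Q : prefish -> Prop) (m : nat) : Prop :=
  exists L : seq prefish,
    size L = m /\
    (forall i, (i < m)%N -> is_fish (nth head_fish L i) /\ Q (nth head_fish L i)) /\
    (forall i j, (i < m)%N -> (j < m)%N ->
        fish_iso (nth head_fish L i) (nth head_fish L j) -> i = j) /\
    (forall F, is_fish F -> Q F ->
        exists2 i, (i < m)%N & fish_iso F (nth head_fish L i)).

(* Main.v *)
Require Import Defs.
From HB Require Import structures.
From mathcomp Require Import all_boot all_order all_algebra.
From mathcomp Require Import boolp ring zify.

Set Implicit Arguments. Unset Strict Implicit. Unset Printing Implicit Defensive.
Import Order.TTheory GRing.Theory Num.Theory.

(* Idea. Call a maximal chain of cells glued along right upper edges a column.
   The columns touching a given column on its right are glued to disjoint runs of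
   consecutive cells of it, so a fish is a rose tree of columns in which a child
   of height h is glued along k cells, for some 1 <= k <= h. As the statement
   only involves u = 1, the fin length may be replaced by the height of the
   column of the head: if u marks that height, then
     P(u) = t (u + b J(u) + a u P(u) + y a b J(u) P(u)),
     (1 - u) J(u) = u (P(1) - P(u)).
   Let U = 1 + O(t) be the series at which the derivative with respect to P of
   the resulting quadratic equation vanishes, V = P(U) and W = P(1). The
   equation and its derivatives in P and u at u = U give
     U = 1 + b (W + y a V^2),    V (1 - t a U^2) = t U^2,
     (W + y a V^2) (1 - t a U + t y a U) = t U (1 + y a V)^2,
   and B = (W + y a V^2) / (1 + y a V) is the parametrization of the theorem. *)

(** * Formal power series *)

(** The summands of the functional equation are read off the lowest item of a column: a single cell
    that is free (u), a single run glued to a child (b J), or a free cell or a glued run below a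
    shorter column (a u P and y a b J P). A child of height h offers the overlaps 1, ..., h, so J
    replaces u^h by u + ... + u^h, and summing this progression gives the second equation. The
    coefficients of P in t are polynomials in u, hence a series U with constant term 1 may be
    substituted for u. Multiplied by 1 - u, the condition that the P-derivative vanish reads U = 1 +
    t(...), a contraction. Iterated series rings are never shown to be integral: each division is
    the cancellation of a regular element (t, b, or a series with constant term 1), and B itself
    comes from a fixed-point equation. On the combinatorial side cells carry numbers that depend on
    the order of construction; a tree is tied to a fish by an ordered listing of its cells, and two
    fish are isomorphic exactly when they have the same tree. *)

Section Series.
Local Open Scope ring_scope.

Definition series (K : Type) := nat -> K.

HB.instance Definition _ (K : Type) := gen_eqMixin (series K).
HB.instance Definition _ (K : Type) := gen_choiceMixin (series K).

Section Ring.
Variable K : comNzRingType.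
Implicit Types f g h : series K.

Definition sconst (c : K) : series K := fun n => if n == 0%N then c else 0.
Definition svar : series K := fun n => if n == 1%N then 1 else 0.
Definition sadd f g : series K := fun n => f n + g n.
Definition sopp f : series K := fun n => - f n.
Definition smul f g : series K := fun n => \sum_(i < n.+1) f i * g (n - i)%N.

Fact saddA : associative sadd.
Proof. by move=> f g h; apply: funext => n; apply: addrA. Qed.
Fact saddC : commutative sadd.
Proof. by move=> f g; apply: funext => n; apply: addrC. Qed.
Fact sadd0 : left_id (sconst 0) sadd.
Proof. by move=> f; apply: funext => n; rewrite /sadd /sconst if_same add0r. Qed.
Fact saddN : left_inverse (sconst 0) sopp sadd.
Proof.
by move=> f; apply: funext => n; rewrite /sadd /sconst if_same; apply: addNr.
Qed.

HB.instance Definition _ := GRing.isZmodule.Build (series K) saddA saddC sadd0 saddN.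

(** The ring laws are inherited from polynomials: a coefficient of a product only depends on
    truncations of the factors. *)
Definition strunc n f : {poly K} := \poly_(i < n.+1) f i.

Lemma coef_strunc n f i : (i <= n)%N -> (strunc n f)`_i = f i.
Proof. by move=> le_in; rewrite coef_poly ltnS le_in. Qed.

Lemma smul_strunc n f g m : (m <= n)%N -> smul f g m = (strunc n f * strunc n g)`_m.
Proof.
move=> le_mn; rewrite coefM; apply: eq_bigr => i _; have := ltn_ord i; rewrite ltnS => le_im.
by rewrite !coef_strunc // ?(leq_trans le_im) // (leq_trans (leq_subr _ _)).
Qed.

Fact smulA : associative smul.
Proof.
move=> f g h; apply: funext => n.
have -> : smul f (smul g h) n = (strunc n f * (strunc n g * strunc n h))`_n.
  rewrite coefM; apply: eq_bigr => i _; have := ltn_ord i; rewrite ltnS => le_in.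
  by rewrite coef_strunc // (@smul_strunc n) // leq_subr.
rewrite mulrA coefM; apply: eq_bigr => i _; have := ltn_ord i; rewrite ltnS => le_in.
by rewrite coef_strunc ?leq_subr // (@smul_strunc n).
Qed.
Fact smulC : commutative smul.
Proof. by move=> f g; apply: funext => n; rewrite !(@smul_strunc n) // mulrC. Qed.
Fact smul1 : left_id (sconst 1) smul.
Proof.
move=> f; apply: funext => n; rewrite /smul big_ord_recl /= subn0 mul1r big1 ?addr0 //.
by move=> i _; rewrite /sconst /= mul0r.
Qed.
Fact smulDl : left_distributive smul sadd.
Proof.
move=> f g h; apply: funext => n; rewrite /sadd /smul -big_split.
by apply: eq_bigr => i _; rewrite mulrDl.
Qed.
Fact sconst1_neq0 : sconst 1 != 0.
Proof. by apply/eqP => /(congr1 (@^~ 0%N)) /eqP; rewrite /= oner_eq0. Qed.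

HB.instance Definition _ :=
  GRing.Zmodule_isComNzRing.Build (series K) smulA smulC smul1 smulDl sconst1_neq0.

Lemma coefsD f g n : (f + g) n = f n + g n. Proof. by []. Qed.
Lemma coefsN f n : (- f) n = - f n. Proof. by []. Qed.
Lemma coefs0 n : (0 : series K) n = 0.
Proof. by rewrite [LHS]/(sconst 0 n) /sconst if_same. Qed.
Lemma coefsM f g n : (f * g) n = \sum_(i < n.+1) f i * g (n - i)%N. Proof. by []. Qed.
Lemma coefs1 n : (1 : series K) n = if n == 0%N then 1 else 0. Proof. by []. Qed.
Lemma coefs_sum I (r : seq I) (P : pred I) (F : I -> series K) n :
  (\sum_(i <- r | P i) F i) n = \sum_(i <- r | P i) F i n.
Proof. by elim/big_rec2: _ => [|i _ f _ <-]; rewrite ?coefs0. Qed.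

Fact sconst_zmod : zmod_morphism sconst.
Proof.
move=> c d; apply: funext => n; rewrite coefsD coefsN /sconst.
by case: eqP => // _; rewrite subr0.
Qed.

Lemma coefs_constM c f n : (sconst c * f) n = c * f n.
Proof.
rewrite coefsM big_ord_recl subn0 big1 ?addr0 // => i _.
by rewrite /sconst /= mul0r.
Qed.

Fact sconst_monoid : monoid_morphism sconst.
Proof.
split=> // c d; apply: funext => n; rewrite coefs_constM /sconst.
by case: eqP => // _; rewrite mulr0.
Qed.

HB.instance Definition _ := GRing.isZmodMorphism.Build K (series K) sconst sconst_zmod.
HB.instance Definition _ := GRing.isMonoidMorphism.Build K (series K) sconst sconst_monoid.

Lemma coefs_varM0 f : (svar * f) 0%N = 0.
Proof. by rewrite coefsM big_ord1 /svar mul0r. Qed.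

Lemma coefs_varM f n : (svar * f) n.+1 = f n.
Proof.
rewrite coefsM 2!big_ord_recl big1 ?addr0; last by move=> i _; rewrite /svar /= mul0r.
by rewrite /svar mul0r add0r mul1r /= /bump subSS subn0.
Qed.

Lemma coefs_varXM i f n : (svar ^+ i * f) n = if (i <= n)%N then f (n - i)%N else 0.
Proof.
elim: i n => [|i IHi] n; first by rewrite expr0 mul1r subn0.
by rewrite exprS -mulrA; case: n => [|n]; rewrite ?coefs_varM0 ?coefs_varM ?IHi.
Qed.

Lemma lreg_svar : GRing.lreg svar.
Proof.
move=> f g eq_fg; apply: funext => n.
by rewrite -coefs_varM eq_fg coefs_varM.
Qed.

Lemma lreg_sconst c : GRing.lreg c -> GRing.lreg (sconst c).
Proof.
move=> reg_c f g eq_fg; apply: funext => n; apply: reg_c.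
by rewrite /= -!coefs_constM eq_fg.
Qed.

Lemma coefsM0 f g : (f * g) 0%N = f 0%N * g 0%N.
Proof. by rewrite coefsM big_ord1. Qed.

(** * Congruence modulo powers of the variable, and fixed points of contractions *)

Definition scongr n f g := forall i, (i < n)%N -> f i = g i.

Lemma scongr_refl n f : scongr n f f. Proof. by []. Qed.

Lemma scongrD n f f' g g' :
  scongr n f f' -> scongr n g g' -> scongr n (f + g) (f' + g').
Proof. by move=> eq_f eq_g i lt_in; rewrite !coefsD eq_f ?eq_g. Qed.

Lemma scongrN n f f' : scongr n f f' -> scongr n (- f) (- f').
Proof. by move=> eq_f i lt_in; rewrite !coefsN eq_f. Qed.

Lemma scongrM n f f' g g' :
  scongr n f f' -> scongr n g g' -> scongr n (f * g) (f' * g').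
Proof.
move=> eq_f eq_g i lt_in; rewrite !coefsM; apply: eq_bigr => j _.
by rewrite eq_f ?eq_g // (leq_ltn_trans _ lt_in) ?leq_subr // -ltnS.
Qed.

Lemma scongrX n k f f' : scongr n f f' -> scongr n (f ^+ k) (f' ^+ k).
Proof.
by move=> eq_f; elim: k => // k IHk; rewrite !exprS; apply: scongrM.
Qed.

Lemma scongr_var n f f' : scongr n f f' -> scongr n.+1 (svar * f) (svar * f').
Proof.
by move=> eq_f [|i] lt_in; rewrite ?coefs_varM0 // !coefs_varM eq_f.
Qed.

Lemma scongr_eq f g : (forall n, scongr n f g) -> f = g.
Proof. by move=> eq_fg; apply: funext => n; apply: (eq_fg n.+1). Qed.

Section Contraction.
Variable Phi : series K -> series K.
Hypothesis PhiP : forall n f g, scongr n f g -> scongr n.+1 (Phi f) (Phi g).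

Lemma contraction_exists : exists f, Phi f = f.
Proof.
pose s m := iter m Phi 0.
have sP n m : scongr n (s (n + m)%N) (s n).
  by elim: n => [//|n IHn]; rewrite addSn; apply: PhiP.
(* By [sP], coefficient n no longer changes from iterate n+1 on. *)
pose f : series K := fun n => s n.+1 n.
have fP n : scongr n f (s n).
  move=> i lt_in; rewrite /f -[in RHS](subnKC lt_in).
  by rewrite (sP i.+1 _ i).
exists f; apply: scongr_eq => -[//|n] i lt_in.
by rewrite (fP n.+1) //; exact: (PhiP (fP n)).
Qed.

End Contraction.

(** Coefficient n of f g is g n plus terms in earlier coefficients of g, so equality propagates
    upward. This gives cancellation over any commutative ring K. *)
Lemma lreg_coef0 f : f 0%N = 1 -> GRing.lreg f.
Proof.
move=> f0 g h eq_fgh; apply: scongr_eq; elim=> [//|n IHn] i.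
rewrite ltnS leq_eqVlt => /orP[/eqP->|/IHn//].
move/(congr1 (@^~ n)): eq_fgh; rewrite /= !coefsM !big_ord_recl f0 !mul1r subn0.
set A := \sum_(_ < _) _; set A' := \sum_(_ < _) _; suff -> : A = A' by move/addIr.
apply: eq_bigr => j _; rewrite IHn //=.
by case: n j {IHn A A'} => [[]//|n] j; rewrite /bump /= subSS ltnS leq_subr.
Qed.

End Ring.
End Series.

(** * Substituting a series for u *)

Section Evaluation.
Local Open Scope ring_scope.
Variables (K R : comNzRingType) (h : {rmorphism K -> series R}).
Implicit Types f g : series K.

(** The series sum_i h(f_i) t^i, where each h(f_i) is itself a series in t; every coefficient is a
    finite sum. *)
Definition seval f : series R := fun n => \sum_(i < n.+1) h (f i) (n - i)%N.

Lemma seval_horner p n :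
  (map_poly h p).[svar R] n = \sum_(i < n.+1) h p`_i (n - i)%N.
Proof.
rewrite (@horner_coef_wide _ (size p + n.+1)); last first.
  by rewrite (leq_trans (size_poly _ _)) ?leq_addr.
rewrite coefs_sum.
under eq_bigr => i _ do rewrite coef_map mulrC coefs_varXM.
rewrite addnC big_split_ord /= [X in _ + X]big1 ?addr0; last first.
  by move=> i _; rewrite leqNgt ltnS leq_addr.
by apply: eq_bigr => i _; rewrite -ltnS ltn_ord.
Qed.

(** On truncations [seval] is polynomial evaluation, from which multiplicativity is inherited. *)
Lemma seval_strunc m f : scongr m.+1 (seval f) ((map_poly h (strunc m f)).[svar R]).
Proof.
move=> n; rewrite ltnS => le_nm; rewrite seval_horner; apply: eq_bigr => i _.
by rewrite coef_strunc // (leq_trans _ le_nm) // -ltnS.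
Qed.

Fact seval_zmod : zmod_morphism seval.
Proof.
move=> f g; apply: funext => n; rewrite coefsD coefsN /seval -sumrB.
by apply: eq_bigr => i _; rewrite coefsD coefsN rmorphB coefsD coefsN.
Qed.

Fact seval_monoid : monoid_morphism seval.
Proof.
split.
  apply: funext => n; rewrite /seval big_ord_recl rmorph1 subn0 big1 ?addr0 //.
  by move=> i _; rewrite coefs1 /= rmorph0 coefs0.
move=> f g; apply: funext => n.
rewrite (scongrM (@seval_strunc n f) (@seval_strunc n g)) //.
rewrite -hornerM -rmorphM seval_horner; apply: eq_bigr => i _.
by rewrite -smul_strunc // -ltnS.
Qed.

HB.instance Definition _ := GRing.isZmodMorphism.Build _ _ seval seval_zmod.
HB.instance Definition _ := GRing.isMonoidMorphism.Build _ _ seval seval_monoid.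

Lemma seval_const c : seval (sconst c) = h c.
Proof.
apply: funext => n; rewrite /seval big_ord_recl subn0 big1 ?addr0 // => i _.
by rewrite /sconst /= rmorph0 coefs0.
Qed.

Lemma seval_var : seval (svar K) = svar R.
Proof.
apply: funext => n.
rewrite (@seval_strunc n.+1) // [strunc _ _](_ : _ = 'X) ?map_polyX ?hornerX //.
apply/polyP => i; rewrite coefX coef_poly /svar.
by case: eqP => [->//|]; rewrite if_same.
Qed.

End Evaluation.

(** * Substitution for u, and derivative in u, of series in t with coefficients polynomial in u *)

Section PolyEval.
Local Open Scope ring_scope.
Variable R : comNzRingType.

Definition hpoly (U : series R) (p : {poly R}) : series R :=
  (map_poly (@sconst R) p).[U].

Fact hpoly_zmod U : zmod_morphism (hpoly U).
Proof. by move=> p q; rewrite /hpoly rmorphB hornerD hornerN. Qed.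
Fact hpoly_monoid U : monoid_morphism (hpoly U).
Proof.
by split=> [|p q]; rewrite /hpoly ?rmorph1 ?hornerC // rmorphM hornerM.
Qed.
HB.instance Definition _ U := GRing.isZmodMorphism.Build _ _ (hpoly U) (hpoly_zmod U).
HB.instance Definition _ U := GRing.isMonoidMorphism.Build _ _ (hpoly U) (hpoly_monoid U).

(** Substitutes U for u. Since the coefficients are polynomials in u, U may have any constant
    term. *)
Definition peval U : series {poly R} -> series R := seval (hpoly U).
HB.instance Definition _ U := GRing.RMorphism.on (peval U).

Lemma peval_var U : peval U (svar _) = svar _.
Proof. exact: seval_var. Qed.

Lemma peval_constC U c : peval U (sconst c%:P) = sconst c.
Proof. by rewrite [LHS]seval_const /= /hpoly map_polyC hornerC. Qed.

Lemma peval_constX U : peval U (sconst 'X) = U.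
Proof. by rewrite [LHS]seval_const /= /hpoly map_polyX hornerX. Qed.

(** A series free of u, as P(1) is in the functional equation. *)
Definition spolyC (W : series R) : series {poly R} := fun n => (W n)%:P.

Lemma peval_polyC U W : peval U (spolyC W) = W.
Proof.
apply: funext => n; rewrite /peval /seval /spolyC big_ord_recr /= subnn big1 => [|i _].
  by rewrite add0r /hpoly map_polyC hornerC.
rewrite /hpoly map_polyC hornerC /= /sconst subn_eq0 leqNgt.
by rewrite [(i < n)%N]ltn_ord.
Qed.

(** The equation that defines U contains [peval U P]; this makes it a contraction. *)
Lemma scongr_peval n f U U' : scongr n U U' -> scongr n (peval U f) (peval U' f).
Proof.
move=> eqU i lt_in; rewrite /peval /seval; apply: eq_bigr => j _.
rewrite /= /hpoly !horner_coef !coefs_sum; apply: eq_bigr => k _.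
by rewrite coef_map /= !coefs_constM (scongrX _ eqU) // (leq_ltn_trans (leq_subr _ _)).
Qed.

Definition sderiv (f : series {poly R}) : series {poly R} := fun n => (f n)^`()%R.

Lemma sderivD f g : sderiv (f + g) = sderiv f + sderiv g.
Proof. by apply: funext => n; rewrite /sderiv !coefsD derivD. Qed.
Lemma sderivB f g : sderiv (f - g) = sderiv f - sderiv g.
Proof. by apply: funext => n; rewrite /sderiv !coefsD !coefsN derivB. Qed.

Lemma sderivM f g : sderiv (f * g) = sderiv f * g + f * sderiv g.
Proof.
apply: funext => n; rewrite /sderiv coefsD !coefsM -big_split raddf_sum.
by apply: eq_bigr => i _; rewrite /= derivM.
Qed.

Lemma sderiv_constC c : sderiv (sconst c%:P) = 0.
Proof.
apply: funext => n; rewrite coefs0 /sderiv /sconst.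
by case: eqP; rewrite (derivC, deriv0).
Qed.

Lemma sderiv_constX : sderiv (sconst 'X) = 1.
Proof.
apply: funext => n; rewrite coefs1 /sderiv /sconst.
by case: eqP; rewrite ?derivX ?deriv0.
Qed.

Lemma sderiv_var : sderiv (svar _) = 0.
Proof.
apply: funext => n; rewrite coefs0 /sderiv /svar.
by case: eqP; rewrite (derivC, deriv0).
Qed.

Lemma sderiv_polyC W : sderiv (spolyC W) = 0.
Proof. by apply: funext => n; rewrite coefs0 /sderiv /spolyC derivC. Qed.

End PolyEval.

(** * Kernel method *)

Section KernelAlgebra.
Local Open Scope ring_scope.
Variables (S : comNzRingType) (t y a b U V W : S).
Hypotheses (reg_t : GRing.lreg t) (reg_b : GRing.lreg b) (reg_U : GRing.lreg U).

Lemma lreg_eq0 (x z : S) : GRing.lreg x -> x * z = 0 -> z = 0.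
Proof. by move=> reg_x xz0; apply: reg_x; rewrite /= mulr0. Qed.

(* Here V, J stand for P(U), J(U), and V', J' for the derivatives at u = U. *)
Lemma kernel_system (J V' J' : S) :
    V = t * (U + b * J + a * U * V + y * a * b * J * V) ->
    (1 - U) * J = U * (W - V) ->
    V' = t * (1 + b * J' + a * (V + U * V') + y * a * b * (J' * V + J * V')) ->
    - J + (1 - U) * J' = W - V - U * V' ->
    U = 1 + t * (b * U - a * U * (1 - U) - y * a * b * U * W
                 + (y * a * b * U * V) *+ 2) ->
  [/\ U = 1 + b * (W + y * a * V ^+ 2),
      (W + y * a * V ^+ 2) * (1 - t * a * U + t * y * a * U)
        = t * U * (1 + y * a * V) ^+ 2
    & V * (1 - t * a * U ^+ 2) = t * U ^+ 2].
Proof.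
move=> h1 h2 h3 h4 hU.
have e1 : V - t * (U + b * J + a * U * V + y * a * b * J * V) = 0 by rewrite -h1 subrr.
have e2 : (1 - U) * J - U * (W - V) = 0 by rewrite h2 subrr.
have e3 : V' - t * (1 + b * J' + a * (V + U * V') + y * a * b * (J' * V + J * V')) = 0.
  by rewrite -h3 subrr.
have e4 : - J + (1 - U) * J' - (W - V - U * V') = 0 by rewrite h4 subrr.
have eU : U - 1 - t * (b * U - a * U * (1 - U) - y * a * b * U * W
                 + (y * a * b * U * V) *+ 2) = 0 by rewrite {1}hU; ring.
(* Eliminating J from the first two equations and adding V times the equation for U leaves t U times
   the claim. *)
have e5 : U - 1 - b * (W + y * a * V ^+ 2) = 0.
  apply: (lreg_eq0 reg_U); apply: (lreg_eq0 reg_t).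
  transitivity ((1 - U) * (V - t * (U + b * J + a * U * V + y * a * b * J * V))
    + t * (b + y * a * b * V) * ((1 - U) * J - U * (W - V))
    + V * (U - 1 - t * (b * U - a * U * (1 - U) - y * a * b * U * W
                 + (y * a * b * U * V) *+ 2))); first by ring.
  by rewrite e1 e2 eU; ring.
(* By [e5], U - 1 is a multiple of b, so b can be cancelled in the equation for U. *)
have e6 : (W + y * a * V ^+ 2) * (1 - t * a * U + t * y * a * U)
        - t * U * (1 + y * a * V) ^+ 2 = 0.
  apply: (lreg_eq0 reg_b).
  transitivity ((U - 1 - t * (b * U - a * U * (1 - U) - y * a * b * U * W
                 + (y * a * b * U * V) *+ 2))
     - (1 - t * a * U) * (U - 1 - b * (W + y * a * V ^+ 2))); first by ring.
  by rewrite e5 eU; ring.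
(* This is the u-derivative after elimination of J and J'. The terms in V' cancel because their
   coefficient is then the P-derivative, which is zero by [eU]. *)
have e7 : V + t * (1 - U *+ 2) * (1 + a * V) + t * b * (1 + y * a * V) * (W - V) = 0.
  transitivity
   ((V - t * (U + b * J + a * U * V + y * a * b * J * V))
    - (1 - U) * (V' - t * (1 + b * J' + a * (V + U * V') + y * a * b * (J' * V + J * V')))
    - t * b * (1 + y * a * V) * (- J + (1 - U) * J' - (W - V - U * V'))
    - t * y * a * b * V' * ((1 - U) * J - U * (W - V))
    - V' * (U - 1 - t * (b * U - a * U * (1 - U) - y * a * b * U * W
                 + (y * a * b * U * V) *+ 2))); first by ring.
  by rewrite e1 e2 e3 e4 eU; ring.
split; apply/eqP; rewrite -subr_eq0; apply/eqP => //.
  by rewrite -[RHS]e5; ring.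
transitivity (U * (V + t * (1 - U *+ 2) * (1 + a * V) + t * b * (1 + y * a * V) * (W - V))
  + t * U * (1 + y * a * V) * (U - 1 - b * (W + y * a * V ^+ 2))
  - (b * V) * ((W + y * a * V ^+ 2) * (1 - t * a * U + t * y * a * U)
        - t * U * (1 + y * a * V) ^+ 2)
  - V * (1 - t * a * U + t * y * a * U) * (U - 1 - b * (W + y * a * V ^+ 2))).
  by ring.
by rewrite e5 e6 e7; ring.
Qed.

(** With B as parameter, U and V become rational: V (1 - z) = B (1 + b B) and U (1 - z) = (1 + b B)
    (1 - z + y z). Both conclusions follow by substitution. *)
Lemma kernel_parametrization (B : S) (z := a * b * B ^+ 2) :
    GRing.lreg (1 + y * a * V) -> GRing.lreg (1 + b * B) ->
    V * (1 - t * a * U ^+ 2) = t * U ^+ 2 ->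
    B = t * (U * (1 + y * a * V + a * B - y * a * B)) ->
    W + y * a * V ^+ 2 = B * (1 + y * a * V) ->
    U = 1 + b * (W + y * a * V ^+ 2) ->
  B * (1 - z) ^+ 2 = t * (1 - z + y * z) ^+ 2 * (1 + a * B) * (1 + b * B) /\
  W * (1 - z) ^+ 2 =
    B * (1 - z) ^+ 2 - y * a * b * B ^+ 3 * (1 + a * B) * (1 + b * B).
Proof.
move=> reg_G reg_bB hV hB hW hU.
have e1 : V - t * U ^+ 2 * (1 + a * V) = 0.
  by rewrite -[RHS](subrr (t * U ^+ 2)) -[X in _ = X - _]hV; ring.
have e2 : B - t * (U * (1 + y * a * V + a * B - y * a * B)) = 0 by rewrite -hB subrr.
have e3 : W + y * a * V ^+ 2 - B * (1 + y * a * V) = 0 by rewrite hW subrr.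
have e4 : U - (1 + b * (B * (1 + y * a * V))) = 0 by rewrite -hW -hU subrr.
(* U is eliminated between V = t U^2 (1 + a V) and the equations for B and U, and the factor 1 + y a
   V is cancelled. *)
have e5 : V - B - b * B ^+ 2 - a * b * B ^+ 2 * V = 0.
  apply: (lreg_eq0 reg_G).
  transitivity ((1 + a * B + y * a * V - y * a * B)
      * (V - t * U ^+ 2 * (1 + a * V))
    - U * (1 + a * V) * (B - t * (U * (1 + y * a * V + a * B - y * a * B)))
    + B * (1 + a * V) * (U - (1 + b * (B * (1 + y * a * V))))).
    by ring.
  by rewrite e1 e2 e4; ring.
have e6 : U * (1 - z) - (1 + b * B) * (1 - z + y * z) = 0.
  transitivity ((1 - z) * (U - (1 + b * (B * (1 + y * a * V))))
     + y * a * b * B * (V - B - b * B ^+ 2 - a * b * B ^+ 2 * V)).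
    by rewrite /z; ring.
  by rewrite e4 e5; ring.
have hz : U * (1 - z) = (1 + b * B) * (1 - z + y * z).
  by apply/eqP; rewrite -subr_eq0 e6.
have hVz : V * (1 - z) = B * (1 + b * B).
  by apply/eqP; rewrite -subr_eq0; apply/eqP; rewrite -[RHS]e5 /z; ring.
split.
  (* The factor 1 + b B comes from V (1 - z). The equation V = t U^2 (1 + a V) is multiplied by (1 -
     z)^3 and rewritten in B, where 1 - z + a B (1 + b B) = 1 + a B as z = a b B^2. *)
  apply: reg_bB => /=.
  transitivity (V * (1 - z) * (1 - z) ^+ 2); first by rewrite hVz; ring.
  have -> : V * (1 - z) = t * U ^+ 2 * (1 - z + a * (V * (1 - z))).
    by apply/eqP; rewrite -subr_eq0; apply/eqP; rewrite -[RHS](mulr0 (1 - z)) -e1; ring.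
  rewrite hVz; transitivity (t * (U * (1 - z)) ^+ 2 * (1 - z + a * (B * (1 + b * B)))).
    by ring.
  by rewrite hz /z; ring.
transitivity ((B * (1 + y * a * V) - y * a * V ^+ 2) * (1 - z) ^+ 2).
  by rewrite -hW; ring.
transitivity (B * (1 - z) ^+ 2 + y * a * (V * (1 - z)) * (B * (1 - z) - V * (1 - z))).
  by ring.
by rewrite hVz /z; ring.
Qed.

End KernelAlgebra.

Section KernelMorphism.
Local Open Scope ring_scope.
Variables (S S' : comNzRingType) (e : {rmorphism S -> S'}).

(** Carries the equations, which hold before u is specialized, through a substitution morphism [e];
    it is applied with [peval U]. *)
Lemma kernel_system_morphism (t y a b x P J P' J' w : S) (t' y' a' b' U W : S') :
    e t = t' -> e y = y' -> e a = a' -> e b = b' -> e x = U -> e w = W ->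
    GRing.lreg t' -> GRing.lreg b' -> GRing.lreg U ->
    P = t * (x + b * J + a * x * P + y * a * b * J * P) ->
    (1 - x) * J = x * (w - P) ->
    P' = t * (1 + b * J' + a * (P + x * P') + y * a * b * (J' * P + J * P')) ->
    - J + (1 - x) * J' = w - P - x * P' ->
    U = 1 + t' * (b' * U - a' * U * (1 - U) - y' * a' * b' * U * W
                 + (y' * a' * b' * U * e P) *+ 2) ->
  [/\ U = 1 + b' * (W + y' * a' * e P ^+ 2),
      (W + y' * a' * e P ^+ 2) * (1 - t' * a' * U + t' * y' * a' * U)
        = t' * U * (1 + y' * a' * e P) ^+ 2
    & e P * (1 - t' * a' * U ^+ 2) = t' * U ^+ 2].
Proof.
move=> <- <- <- <- <- <- reg_t reg_b reg_U hP hJ hP' hJ'.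
apply: (kernel_system reg_t reg_b reg_U (J := e J) (V' := e P') (J' := e J')).
- by rewrite {1}hP !(rmorphM, rmorphD).
- by rewrite -rmorphB -rmorphM -hJ rmorphM rmorphB rmorph1.
- by rewrite {1}hP' !(rmorphM, rmorphD, rmorph1).
- by rewrite -!rmorphM -!rmorphB -hJ' rmorphD rmorphN rmorphM rmorphB rmorph1.
Qed.

End KernelMorphism.

Section Kernel.
Local Open Scope ring_scope.
Variables (R : comNzRingType) (y a b : R) (P J : series {poly R}) (W : series R).
Hypotheses (reg_b : GRing.lreg b).
Let t := svar R.
Let C (c : R) := sconst c%:P.
Hypothesis P_eq : P = svar _ * (sconst 'X + C b * J + C a * sconst 'X * P
                                + C y * C a * C b * J * P).
Hypothesis J_eq : (1 - sconst 'X) * J = sconst 'X * (spolyC W - P).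
Let ys := sconst y. Let as_ := sconst a. Let bs := sconst b.

Lemma coef0_addM_svar (f : series R) : (1 + t * f) 0%N = 1.
Proof. by rewrite coefsD coefs_varM0 addr0. Qed.

Lemma lreg_addM_svar (f : series R) : GRing.lreg (1 + t * f).
Proof. exact/lreg_coef0/coef0_addM_svar. Qed.

Lemma sderiv1 : sderiv (1 : series {poly R}) = 0.
Proof. by rewrite -(rmorph1 (@sconst _)) -polyC1 sderiv_constC. Qed.

Lemma sderiv_P : sderiv P = svar _ * (1 + C b * sderiv J + C a * (P + sconst 'X * sderiv P)
       + C y * C a * C b * (sderiv J * P + J * sderiv P)).
Proof.
rewrite {1}P_eq sderivM sderiv_var !sderivD !sderivM !sderiv_constC sderiv_constX.
by ring.
Qed.

Lemma sderiv_J :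
  - J + (1 - sconst 'X) * sderiv J = spolyC W - P - sconst 'X * sderiv P.
Proof.
have := congr1 (@sderiv _) J_eq.
rewrite !sderivM !sderivB sderiv_polyC sderiv1 sderiv_constX sub0r mulN1r => ->.
by ring.
Qed.

(** The leading factor t makes the right-hand side a contraction, and the constant term 1 makes its
    fixed point regular. *)
Lemma kernel_root : exists2 U : series R, GRing.lreg U &
  U = 1 + t * (bs * U - as_ * U * (1 - U) - ys * as_ * bs * U * W
                 + (ys * as_ * bs * U * peval U P) *+ 2).
Proof.
have [U hU] : exists U, 1 + t * (bs * U - as_ * U * (1 - U) - ys * as_ * bs * U * W
                 + (ys * as_ * bs * U * peval U P) *+ 2) = U.
  apply: contraction_exists => n f g eq_fg.
  have eq_P := scongr_peval P eq_fg.
  apply: scongrD; first exact: scongr_refl.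
  apply: scongr_var.
  apply: scongrD; last first.
    rewrite !mulr2n; have eq_Q := scongrM (scongrM (@scongr_refl _ n (ys * as_ * bs)) eq_fg) eq_P.
    exact: scongrD.
  apply: scongrD; last first.
    apply: scongrN; apply: scongrM; last exact: scongr_refl.
    apply: scongrM => //; exact: scongr_refl.
  apply: scongrD; first by apply: scongrM => //; exact: scongr_refl.
  apply: scongrN; apply: scongrM.
    apply: scongrM => //; exact: scongr_refl.
  by apply: scongrD; [exact: scongr_refl | apply: scongrN].
by exists U => //; rewrite -hU; apply: lreg_addM_svar.
Qed.

Theorem kernel_method : exists2 B : series R, B 0%N = 0 & let z := as_ * bs * B ^+ 2 in
  B * (1 - z) ^+ 2 = t * (1 - z + ys * z) ^+ 2 * (1 + as_ * B) * (1 + bs * B) /\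
  W * (1 - z) ^+ 2 =
    B * (1 - z) ^+ 2 - ys * as_ * bs * B ^+ 3 * (1 + as_ * B) * (1 + bs * B).
Proof.
have [U reg_U hU] := kernel_root.
have [] := kernel_system_morphism (peval_var U) (peval_constC U y) (peval_constC U a)
  (peval_constC U b) (peval_constX U) (peval_polyC U W) (@lreg_svar R)
  (lreg_sconst reg_b) reg_U P_eq J_eq sderiv_P sderiv_J hU.
rewrite -/ys -/as_ -/bs -/t; set V : series R := peval U P => hUW hW hV.
have V0 : V 0%N = 0.
  have -> : V = t * (U ^+ 2 * (1 + as_ * V)).
    by rewrite -[LHS]addr0 -(subrr (t * U ^+ 2)) -{2}hV; ring.
  exact: coefs_varM0.
(* This is [hW] with W + y a V^2 = B (1 + y a V) inserted, the factor 1 + y a V cancelled, and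
   solved for B: the quotient is obtained without division. *)
have [B hB] : exists B, t * (U * (1 + ys * as_ * V + as_ * B - ys * as_ * B)) = B.
  apply: contraction_exists => n f g eq_fg; apply: scongr_var.
  apply: scongrM; first exact: scongr_refl.
  apply: scongrD; last first.
    by apply: scongrN; apply: scongrM => //; exact: scongr_refl.
  apply: scongrD; first exact: scongr_refl.
  by apply: scongrM => //; exact: scongr_refl.
have B0 : B 0%N = 0 by rewrite -hB coefs_varM0.
have reg_G : GRing.lreg (1 + ys * as_ * V).
  by apply: lreg_coef0; rewrite coefsD coefsM0 V0 mulr0 addr0.
have reg_bB : GRing.lreg (1 + bs * B).
  by apply: lreg_coef0; rewrite coefsD coefsM0 B0 mulr0 addr0.
have hWB : W + ys * as_ * V ^+ 2 = B * (1 + ys * as_ * V).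
  (* Both sides agree after multiplication by 1 - t a U + t y a U, whose constant term is 1. *)
  apply: (lreg_addM_svar (f := ys * as_ * U - as_ * U)) => /=.
  have -> : 1 + t * (ys * as_ * U - as_ * U) = 1 - t * as_ * U + t * ys * as_ * U.
    by ring.
  rewrite mulrC hW; apply/eqP; rewrite -subr_eq0 -(mulr0 (1 + ys * as_ * V)).
  have eB : t * (U * (1 + ys * as_ * V + as_ * B - ys * as_ * B)) - B = 0.
    by rewrite hB subrr.
  by rewrite -eB; apply/eqP; ring.
exists B => //.
exact: (kernel_parametrization reg_G reg_bB hV (esym hB) hWB hUW).
Qed.
End Kernel.

(** * Trees of columns *)

(* A tree lists the cells of a column from bottom to top: [Free] stands for a cell
   whose right lower edge is free, [Glue D k] for a run of [k] cells glued to the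
   [k] lowest cells of the column [D]; [Leaf] and [Cap D k] are the same two items
   at the top of the column. *)
Inductive ftree :=
  | Leaf
  | Cap of ftree & nat
  | Free of ftree
  | Glue of ftree & nat & ftree.

HB.instance Definition _ := gen_eqMixin ftree.

Fixpoint height T :=
  match T with
  | Leaf => 1
  | Cap _ k => k
  | Free T => (height T).+1
  | Glue _ k T => k + height T
  end.

Fixpoint valid T :=
  match T with
  | Leaf => true
  | Cap D k => valid D && (0 < k <= height D)
  | Free T => valid T
  | Glue D k T => [&& valid D, 0 < k <= height D & valid T]
  end.

(* [lexp], [rexp] and [texp] are the exponents of b, a and y: left size, right size
   and number of tails, each minus one; [tree_order] is that of t. *)
Fixpoint lexp T :=
  match T with
  | Leaf => 0
  | Cap D _ => (lexp D).+1
  | Free T => lexp T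
  | Glue D _ T => (lexp D + lexp T).+1
  end.

Fixpoint rexp T :=
  match T with
  | Leaf => 0
  | Cap D _ => rexp D
  | Free T => (rexp T).+1
  | Glue D _ T => (rexp D + rexp T).+1
  end.

Fixpoint texp T :=
  match T with
  | Leaf => 0
  | Cap D _ => texp D
  | Free T => texp T
  | Glue D _ T => (texp D + texp T).+1
  end.

Definition tree_order T := (lexp T + rexp T).+1.

(** Parameter of the enumeration [trees]. As the order bounds the depth, [trees d] contains all
    valid trees of order at most d. *)
Fixpoint depth T :=
  match T with
  | Leaf => 1
  | Cap D _ => (depth D).+1
  | Free T => (depth T).+1
  | Glue D _ T => (maxn (depth D) (depth T)).+1
  end.

Lemma depth_tree_order T : depth T <= tree_order T.
Proof. by rewrite /tree_order; elim: T => //= *; lia. Qed.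

Definition overlaps (s : seq ftree) := [seq (D, k) | D <- s, k <- iota 1 (height D)].

Fixpoint trees d :=
  if d is d.+1 then
    Leaf :: [seq Cap p.1 p.2 | p <- overlaps (trees d)]
         ++ [seq Free T | T <- trees d]
         ++ [seq Glue p.1 p.2 T | p <- overlaps (trees d), T <- trees d]
  else [::].

Lemma mem_overlaps s D k : ((D, k) \in overlaps s) = (D \in s) && (0 < k <= height D).
Proof.
apply/allpairsPdep/andP => [[D' [k' [sD' + [-> ->]]]]|[sD kD]].
  by rewrite mem_iota add1n ltnS.
by exists D, k; rewrite mem_iota add1n ltnS.
Qed.

Lemma mem_trees d T : (T \in trees d) = valid T && (depth T <= d).
Proof.
elim: d T => [|d IHd] T; first by case: T => *; rewrite ?andbF.
rewrite /= in_cons !mem_cat; apply/idP/idP.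
  case/or4P => [/eqP-> // | /mapP[[D k] /=] | /mapP[T'] | /allpairsP[[[D k] T'] /=]].
  - by rewrite mem_overlaps IHd => /andP[/andP[vD dD] kD] -> /=; rewrite vD kD.
  - by rewrite IHd => /andP[vT dT] -> /=; rewrite vT.
  - rewrite mem_overlaps !IHd => -[/andP[/andP[vD dD] kD] /andP[vT dT] ->] /=.
    by rewrite vD kD vT ltnS geq_max dD.
case: T => [|D k|T|D k T] /=; rewrite ?eqxx ?ltnS ?geq_max => //.
- case/andP=> /andP[vD kD] dD; apply/orP; right; apply/or3P/Or31/mapP.
  by exists (D, k); rewrite //= mem_overlaps IHd vD dD.
- case/andP=> vT dT; apply/orP; right; apply/or3P/Or32/mapP.
  by exists T; rewrite // IHd vT.
- case/andP=> /and3P[vD kD vT] /andP[dD dT]; apply/orP; right; apply/or3P/Or33.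
  apply/allpairsP; exists ((D, k), T); split=> //=; first by rewrite mem_overlaps IHd vD dD.
  by rewrite IHd vT.
Qed.

Lemma uniq_overlaps s : uniq s -> uniq (overlaps s).
Proof.
move=> us; apply: allpairs_uniq_dep => // [D _|]; first exact: iota_uniq.
by case=> [D k] [D' k'] _ _ /= [-> ->].
Qed.

Lemma uniq_trees d : uniq (trees d).
Proof.
elim: d => //= d IHd; have uG := uniq_overlaps IHd.
rewrite !cat_uniq !has_cat !mem_cat !negb_or.
have u1 : uniq [seq Cap p.1 p.2 | p <- overlaps (trees d)].
  by rewrite map_inj_uniq // => -[D k] [D' k'] [-> ->].
have u2 : uniq [seq Free T | T <- trees d] by rewrite map_inj_uniq // => T T' [].
have u3 : uniq [seq Glue p.1 p.2 T | p <- overlaps (trees d), T <- trees d].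
  by apply: allpairs_uniq => //= -[[D k] T] [[D' k'] T'] _ _ [-> -> ->].
rewrite u1 u2 u3 /= andbT; apply/and3P; split.
- apply/and3P; split; apply/negP; first by case/mapP.
    by case/mapP.
  by case/allpairsP => -[p T] [].
- apply/andP; split; apply/hasPn => T.
    by case/mapP=> T' _ ->; apply/negP => /mapP[].
  by case/allpairsP => -[p T'] [_ _ ->]; apply/negP => /mapP[].
- apply/hasPn => T; case/allpairsP => -[p T'] [_ _ ->].
  by apply/negP => /mapP[].
Qed.

(** * The functional equation for trees *)

Section GeneratingFunction.
Local Open Scope ring_scope.
Variables (R : comNzRingType) (y a b : R).

Definition weight T : R := y ^+ texp T * a ^+ rexp T * b ^+ lexp T.

Definition fish_series : series {poly R} :=
  fun n => \sum_(T <- trees n | tree_order T == n) (weight T)%:P * 'X^(height T).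

(* The series J of the functional equation, P being [fish_series] and P(1)
   [total_series]. *)
Definition overlap_series : series {poly R} := fun n =>
  \sum_(T <- trees n | tree_order T == n) (weight T)%:P * (\sum_(k <- iota 1 (height T)) 'X^k).

Definition total_series : series R := fun n =>
  \sum_(T <- trees n | tree_order T == n) weight T.

(** Trees of depth greater than n have order greater than n. All factors of a convolution can thus
    be summed over one common list. *)
Lemma sum_trees (A : nmodType) (F : ftree -> A) m n : (n <= m)%N ->
  \sum_(T <- trees m | tree_order T == n) F T = \sum_(T <- trees n | tree_order T == n) F T.
Proof.
move=> le_nm; rewrite -!(big_filter _ (fun T => tree_order T == n)); apply: perm_big.
apply: uniq_perm; rewrite ?filter_uniq ?uniq_trees // => T.
rewrite !mem_filter !mem_trees; case: eqP => //= eq_n.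
by case: (valid T) => //=; have := depth_tree_order T; lia.
Qed.

Lemma fish_series_wide m n : (n <= m)%N -> fish_series n =
  \sum_(T <- trees m | tree_order T == n) (weight T)%:P * 'X^(height T).
Proof. by move=> le_nm; rewrite sum_trees. Qed.

Lemma overlap_series_wide m n : (n <= m)%N -> overlap_series n =
  \sum_(T <- trees m | tree_order T == n)
     (weight T)%:P * (\sum_(k <- iota 1 (height T)) 'X^k).
Proof. by move=> le_nm; rewrite sum_trees. Qed.

(** For each tree, (1 - u)(u + ... + u^h) = u (1 - u^h), by induction on the height h. *)
Lemma overlap_series_eq :
  (1 - sconst 'X) * overlap_series = sconst 'X * (spolyC total_series - fish_series).
Proof.
apply: funext => n; rewrite mulrBl mul1r !(coefsD, coefsN) !coefs_constM.
rewrite !(coefsD, coefsN) /spolyC /overlap_series /fish_series /total_series.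
rewrite rmorph_sum -!sumrB !mulr_sumr -sumrB; apply: eq_bigr => T _.
elim: (height T) => [|h IHh]; first by rewrite big_nil expr0; ring.
have -> : iota 1 h.+1 = iota 1 h ++ [:: h.+1] by rewrite -[X in iota 1 X](addn1 h) iotaD.
rewrite big_cat big_seq1 /= !mulrDr opprD addrACA IHh !exprS; ring.
Qed.

Lemma sum_overlaps (A : nmodType) (s : seq ftree) (G : ftree -> nat -> A) :
  \sum_(p <- overlaps s) G p.1 p.2 = \sum_(D <- s) \sum_(k <- iota 1 (height D)) G D k.
Proof. by rewrite big_allpairs_dep. Qed.

(** The order of [Glue D k T] is one more than the sum of the orders of D and T, so the sum is a
    Cauchy product; the sum over k makes D contribute to J. *)
Lemma sum_glue n : \sum_(T <- [seq Glue p.1 p.2 T | p <- overlaps (trees n), T <- trees n])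
     (if tree_order T == n.+1 then (weight T)%:P * 'X^(height T) else 0) =
  y%:P * (a%:P * (b%:P * (overlap_series * fish_series) n)).
Proof.
rewrite big_allpairs_dep (sum_overlaps _ (fun D k => \sum_(T <- _) (if tree_order (Glue D k T) == n.+1
  then (weight (Glue D k T))%:P * 'X^(height (Glue D k T)) else 0))) /=.
pose H D T := (weight D)%:P * (\sum_(k <- iota 1 (height D)) 'X^k)
   * ((weight T)%:P * 'X^(height T)) : {poly R}.
transitivity (\sum_(D <- trees n) \sum_(T <- trees n)
   (if tree_order D + tree_order T == n then (y * a * b)%:P * H D T else 0)).
  apply: eq_bigr => D _; rewrite exchange_big; apply: eq_bigr => T _ /=.
  have eq_order k : (tree_order (Glue D k T) == n.+1) = (tree_order D + tree_order T == n)%N.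
    by rewrite /tree_order /=; apply/eqP/eqP; lia.
  under eq_bigr => k _ do rewrite eq_order.
  case: ifP => _; last by rewrite big1.
  rewrite /H mulr_sumr mulr_suml mulr_sumr; apply: eq_bigr => k _.
  rewrite /weight /= exprD !exprS !exprD !rmorphM /=; ring.
have -> : (overlap_series * fish_series) n = \sum_(D <- trees n) \sum_(T <- trees n)
   (if tree_order D + tree_order T == n then H D T else 0).
  rewrite coefsM; transitivity (\sum_(i < n.+1) \sum_(D <- trees n) \sum_(T <- trees n)
     (if tree_order D == i then if tree_order T == (n - i)%N then H D T else 0 else 0)).
    apply: eq_bigr => i _; rewrite (fish_series_wide (leq_subr i n)).
    have le_in : (i <= n)%N by rewrite -ltnS.
    rewrite (overlap_series_wide le_in) big_mkcond mulr_suml.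
    apply: eq_bigr => D _; case: ifP => _; last by rewrite mul0r big1.
    by rewrite -[RHS]big_mkcond [LHS]mulr_sumr.
  rewrite exchange_big; apply: eq_bigr => D _; rewrite exchange_big; apply: eq_bigr => T _ /=.
  (* Of all indices i of the convolution only i = [tree_order D] can contribute. *)
  case: eqP => [<-|neq].
    rewrite (bigD1 (inord (tree_order D))) //= inordK ?ltnS ?leq_addr // eqxx addKn eqxx.
    rewrite big1 ?addr0 // => i neq_i; case: eqP => // eq_i; case/eqP: neq_i.
    by apply: val_inj; rewrite /= inordK ?ltnS ?leq_addr.
  rewrite big1 // => i _; case: eqP => // eq_i; case: eqP => // eq_j.
  by case: neq; have := ltn_ord i; lia.
rewrite !mulr_sumr; apply: eq_bigr => D _; rewrite !mulr_sumr; apply: eq_bigr => T _.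
by case: ifP; rewrite ?mulr0 // !rmorphM !mulrA.
Qed.

(** One summand for each constructor, in the order in which [trees] lists them. *)
Lemma fish_series_eq : fish_series = svar _ *
  (sconst 'X + sconst b%:P * overlap_series + sconst a%:P * sconst 'X * fish_series
     + sconst y%:P * sconst a%:P * sconst b%:P * overlap_series * fish_series).
Proof.
apply: funext => -[|n]; first by rewrite coefs_varM0 /fish_series big_nil.
rewrite coefs_varM !coefsD coefs_constM -!mulrA !coefs_constM.
rewrite [LHS]/fish_series big_mkcond big_cons !big_cat /= !big_map sum_glue !addrA.
congr (_ + _ + _ + _).
- rewrite /tree_order /sconst eqSS eq_sym /weight !expr0 !mulr1 expr1.
  by case: eqP => //; rewrite mul1r.
- rewrite (sum_overlaps _ (fun D k => if tree_order (Cap D k) == n.+1 then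
     (weight (Cap D k))%:P * 'X^k else 0)) /overlap_series mulr_sumr big_mkcond.
  rewrite [RHS]big_mkcond /=; apply: eq_bigr => D _.
  transitivity (\sum_(k <- iota 1 (height D))
    (if tree_order D == n then (weight (Cap D k))%:P * 'X^k else 0)); first by [].
  case: ifP => _; last by rewrite big1.
  rewrite !mulr_sumr; apply: eq_bigr => k _; rewrite /weight /= exprS !rmorphM /=; ring.
- rewrite /fish_series !mulr_sumr [RHS]big_mkcond /=; apply: eq_bigr => T _.
  have -> : tree_order (Free T) = (tree_order T).+1 by rewrite /tree_order /= addnS.
  rewrite eqSS; case: ifP => // _; rewrite /weight /= !exprS !rmorphM /=; ring.
Qed.
End GeneratingFunction.

(** * Series in four variables *)

(** Turns the polynomial identities of the kernel method into the fractions of the theorem, v being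
    the inverse of 1 - z. *)
Lemma inverse_form (S : comNzRingType) (t y a b B W v : S) (z := (a * b * B ^+ 2)%R) :
    (B * (1 - z) ^+ 2 = t * (1 - z + y * z) ^+ 2 * (1 + a * B) * (1 + b * B))%R ->
    (W * (1 - z) ^+ 2
       = B * (1 - z) ^+ 2 - y * a * b * B ^+ 3 * (1 + a * B) * (1 + b * B))%R ->
    ((1 - z) * v = 1)%R ->
  (B = t * (1 + y * (z * v)) ^+ 2 * (1 + a * B) * (1 + b * B))%R /\
  (W = B - y * a * b * B ^+ 3 * (1 + a * B) * (1 + b * B) * v ^+ 2)%R.
Proof.
move=> eqB eqW zv; have zv2 : ((1 - z) ^+ 2 * v ^+ 2 = 1)%R by rewrite -exprMn zv expr1n.
split.
  transitivity (B * ((1 - z) ^+ 2 * v ^+ 2))%R; first by rewrite zv2 mulr1.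
  rewrite (mulrA B) eqB.
  have -> : (1 + y * (z * v) = (1 - z + y * z) * v)%R by rewrite mulrDl zv mulrA.
  by ring.
transitivity (W * ((1 - z) ^+ 2 * v ^+ 2))%R; first by rewrite zv2 mulr1.
by rewrite (mulrA W) eqW mulrBl -(mulrA B) zv2 mulr1.
Qed.

Section FourVariables.
Local Open Scope ring_scope.

(** With t as outermost variable, then y, a, b, [series4] is convertible to [fps], so a cast
    suffices to pass between them. *)
Definition series3 := series (series (series rat)).
HB.instance Definition _ := GRing.ComNzRing.on series3.
Definition series4 := series series3.
HB.instance Definition _ := GRing.ComNzRing.on series4.

Definition var_y : series3 := svar _.
Definition var_a : series3 := sconst (svar _).
Definition var_b : series3 := sconst (sconst (svar _)).

Lemma fmulE (f g : fps) : fmul f g = (f : series4) * (g : series4).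
Proof.
apply: funext => n1; apply: funext => n2; apply: funext => n3; apply: funext => n4.
rewrite coefsM !coefs_sum; apply: eq_bigr => i1 _.
rewrite coefsM !coefs_sum; apply: eq_bigr => i2 _.
by rewrite coefsM !coefs_sum; apply: eq_bigr => i3 _.
Qed.

Lemma faddE (f g : fps) : fadd f g = (f : series4) + (g : series4).
Proof. by []. Qed.

Lemma fsubE (f g : fps) : fsub f g = (f : series4) - (g : series4).
Proof. by []. Qed.

Lemma foneE : fone = 1 :> series4.
Proof.
apply: funext => -[|n1]; apply: funext => -[|n2]; apply: funext => -[|n3];
by apply: funext => -[|n4].
Qed.

Lemma fpowE (f : fps) k : fpow f k = (f : series4) ^+ k.
Proof. by elim: k => [|k IHk]; rewrite /= ?foneE // exprS -IHk fmulE. Qed.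

Lemma ftE : ft = svar _ :> series4.
Proof.
apply: funext => -[|[|n1]]; apply: funext => -[|n2]; apply: funext => -[|n3];
by apply: funext => -[|n4].
Qed.

Lemma fyE : fy = sconst var_y :> series4.
Proof.
apply: funext => -[|n1]; apply: funext => -[|[|n2]]; apply: funext => -[|n3];
by apply: funext => -[|n4].
Qed.

Lemma faE : fa = sconst var_a :> series4.
Proof.
apply: funext => -[|n1]; apply: funext => -[|n2]; apply: funext => -[|[|n3]];
by apply: funext => -[|n4].
Qed.

Lemma fbE : fb = sconst var_b :> series4.
Proof.
apply: funext => -[|n1]; apply: funext => -[|n2]; apply: funext => -[|n3];
by apply: funext => -[|[|n4]].
Qed.

(** Every monomial of X has positive total degree, so those of X^k have total degree at least k. *)
Lemma fpow_coef_eq0 (X : fps) k n1 n2 n3 n4 : X 0%N 0%N 0%N 0%N = 0 ->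
  (n1 + n2 + n3 + n4 < k)%N -> fpow X k n1 n2 n3 n4 = 0.
Proof.
move=> X0; elim: k n1 n2 n3 n4 => // k IHk n1 n2 n3 n4; rewrite ltnS => le_nk.
rewrite /= /fmul; apply: big1 => i1 _; apply: big1 => i2 _; apply: big1 => i3 _; apply: big1 => i4 _.
have := ltn_ord i1; have := ltn_ord i2; have := ltn_ord i3; have := ltn_ord i4.
have [|i_gt0] := posnP (i1 + i2 + i3 + i4)%N.
  move/eqP; rewrite !addn_eq0 => /andP[/andP[/andP[/eqP-> /eqP->] /eqP->] /eqP->] _ _ _ _.
  by rewrite X0 mul0r.
by move=> *; rewrite IHk ?mulr0 //; lia.
Qed.

(** With X = 1 - f, the product of f and the powers of X up to N sums to 1 - X^(N+1), which agrees
    with 1 up to total degree N. *)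
Lemma finvP (f : fps) : f 0%N 0%N 0%N 0%N = 1 -> (f : series4) * (Defs.finv f : series4) = 1.
Proof.
move=> f0; rewrite -fmulE.
apply: funext => n1; apply: funext => n2; apply: funext => n3; apply: funext => n4.
rewrite /Defs.finv f0 invr1; set X := fsub fone (fscale 1 f).
have XE : X = 1 - (f : series4).
  have scale1 : fscale 1 f = f.
    apply: funext => i1; apply: funext => i2; apply: funext => i3; apply: funext => i4.
    exact: mul1r.
  by rewrite /X scale1 fsubE foneE.
have X0 : X 0%N 0%N 0%N 0%N = 0.
  by rewrite /X /fsub /fadd /fopp /fscale /fone /fconst /= f0 mulr1 subrr.
set N := (n1 + n2 + n3 + n4)%N.
(* [finv] stops each sum at the total degree of the coefficient; further powers vanish there, so one
   bound N serves the whole convolution. *)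
have sumE i1 i2 i3 i4 : (i1 + i2 + i3 + i4 <= N)%N ->
   \sum_(k < (i1 + i2 + i3 + i4).+1) fpow X k i1 i2 i3 i4 =
   (\sum_(k < N.+1) (X : series4) ^+ k) i1 i2 i3 i4.
  move=> le_iN; rewrite !coefs_sum -(big_mkord xpredT (fun k => fpow X k i1 i2 i3 i4)).
  rewrite -(big_mkord xpredT (fun k => ((X : series4) ^+ k) i1 i2 i3 i4)).
  rewrite [RHS](big_cat_nat (n := (i1 + i2 + i3 + i4).+1)) //= [X in _ + X]big_nat_cond.
  rewrite [X in _ + X]big1 ?addr0 => [|k /andP[/andP[lt_ik _] _]].
    by apply: eq_bigr => k _; rewrite fpowE.
  by rewrite -fpowE fpow_coef_eq0.
transitivity (((f : series4) * (\sum_(k < N.+1) (X : series4) ^+ k)) n1 n2 n3 n4).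
  rewrite -fmulE; apply: eq_bigr => i1 _; apply: eq_bigr => i2 _.
  apply: eq_bigr => i3 _; apply: eq_bigr => i4 _; rewrite /fscale mul1r sumE //.
  by rewrite /N; lia.
have -> : (f : series4) = 1 - (X : series4) by rewrite XE opprB addrC subrK.
rewrite -opprB mulNr -subrX1 opprB !coefsD !coefsN.
by rewrite -fpowE fpow_coef_eq0 // subr0.
Qed.

Local Notation t := (svar _ : series4).
Local Notation y := (sconst var_y : series4).
Local Notation a := (sconst var_a : series4).
Local Notation b := (sconst var_b : series4).

Lemma abB2E (B : fps) : fmul (fmul fa fb) (fpow B 2) = a * b * (B : series4) ^+ 2.
Proof. by rewrite !fmulE fpowE faE fbE. Qed.

Lemma coef0_abB2 (B : series4) : (a * b * B ^+ 2) 0%N 0%N 0%N 0%N = 0.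
Proof. by rewrite !coefsM0 /sconst /= /var_a /sconst /= /svar !mul0r. Qed.

Lemma B_equationE (B : series4) (v : series4) : (1 - a * b * B ^+ 2) * v = 1 ->
  B_equation B <->
  B = t * (1 + y * (a * b * B ^+ 2 * v)) ^+ 2 * (1 + a * B) * (1 + b * B).
Proof.
move=> zv; have fv : Defs.finv (fsub fone (a * b * B ^+ 2)) = v :> series4.
  have := @finvP (fsub fone (a * b * B ^+ 2)); rewrite fsubE foneE.
  set w : series4 := Defs.finv _ => inv; rewrite -[w]mulr1 -zv mulrCA mulrA inv ?mul1r //.
  by rewrite !coefsD !coefsN coef0_abB2 subr0.
rewrite /B_equation /fdiv abB2E fv !fmulE fpowE !faddE !foneE fyE faE fbE ftE.
by [].
Qed.

Lemma P_formulaE (B : series4) (v : series4) : (1 - a * b * B ^+ 2) ^+ 2 * v = 1 ->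
  P_formula B = B - y * a * b * B ^+ 3 * (1 + a * B) * (1 + b * B) * v.
Proof.
move=> zv; have fv : Defs.finv (fpow (fsub fone (a * b * B ^+ 2)) 2) = v :> series4.
  have := @finvP (fpow (fsub fone (a * b * B ^+ 2)) 2); rewrite fpowE fsubE foneE.
  set w : series4 := Defs.finv _ => inv; rewrite -[w]mulr1 -zv mulrCA mulrA inv ?mul1r //.
  by rewrite expr2 !coefsM0 !coefsD !coefsN coef0_abB2 subr0 mulr1.
by rewrite /P_formula /fdiv abB2E fv !fmulE fpowE fsubE !faddE !foneE fyE faE fbE.
Qed.

Lemma one_sub_abB2_inv (B : series4) : exists v : series4, (1 - a * b * B ^+ 2) * v = 1.
Proof.
exists (Defs.finv (1 - a * b * B ^+ 2)); apply: finvP.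
by rewrite !coefsD !coefsN coef0_abB2 subr0.
Qed.

(** Agreement of B and B' modulo t^n passes to the right-hand sides, where the factor t gains one
    degree. *)
Lemma B_equation_unique (B B' : fps) : B_equation B -> B_equation B' -> B' = B.
Proof.
have [v zv] := one_sub_abB2_inv B; have [v' zv'] := one_sub_abB2_inv B'.
move=> /(B_equationE zv) eqB /(B_equationE zv') eqB'.
apply: (@scongr_eq series3 B' B); elim=> [//|n IHn].
have eqz : scongr n (a * b * (B' : series4) ^+ 2) (a * b * (B : series4) ^+ 2).
  by apply: scongrM; [exact: scongr_refl | exact: scongrX].
(* Both inverses are written as v (1 - ...) v', so that they differ in the middle factor only. *)
have eqv : scongr n v' v.
  have -> : v' = v * ((1 - a * b * (B : series4) ^+ 2) * v') by rewrite mulrCA mulrA zv mul1r.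
  have {2}-> : v = v * ((1 - a * b * (B' : series4) ^+ 2) * v') by rewrite zv' mulr1.
  apply: scongrM; first exact: scongr_refl.
  apply: scongrM; last exact: scongr_refl.
  by apply: scongrD; [exact: scongr_refl | apply: scongrN => i /eqz].
rewrite eqB eqB' -!(mulrA t); apply: scongr_var.
have eq1 (c : series4) : scongr n (1 + c * (B' : series4)) (1 + c * (B : series4)).
  by apply: scongrD; [exact: scongr_refl | apply: scongrM; first exact: scongr_refl].
apply: scongrM; last exact: eq1.
apply: scongrM; last exact: eq1.
apply: scongrX; apply: scongrD; first exact: scongr_refl.
apply: scongrM; first exact: scongr_refl.
exact: scongrM.
Qed.

Theorem total_series_formula :
  exists2 B : fps, B_equation B & P_formula B = total_series var_y var_a var_b.
Proof.
have reg_b : GRing.lreg var_b by do 2 apply: lreg_sconst; apply: lreg_svar.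
have [B B0 []] := kernel_method reg_b (fish_series_eq var_y var_a var_b)
  (overlap_series_eq var_y var_a var_b).
move=> eqB eqW; have [v zv] := one_sub_abB2_inv B.
have [solB solW] := inverse_form eqB eqW zv.
exists B; first exact/(B_equationE zv).
rewrite (@P_formulaE B (v ^+ 2)); last by rewrite -exprMn zv expr1n.
by rewrite -solW.
Qed.

End FourVariables.

(** * Fish represented by trees *)

Section Column.
Implicit Types (u : nat -> option nat) (cs : seq nat).

(** The last cell must have a free right upper edge, so the list is determined by its first cell. *)
Fixpoint column u cs : Prop :=
  if cs is c :: cs' then
    if cs' is d :: _ then u c = Some d /\ column u cs' else u c = None
  else False.

Lemma column_cons u c cs : column u (c :: cs) -> cs <> [::] ->
  u c = Some (head 0 cs) /\ column u cs.
Proof. by case: cs. Qed.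

Lemma cat_neq0 cs1 cs2 : cs2 <> [::] :> seq nat -> cs1 ++ cs2 <> [::].
Proof. by case: cs1. Qed.

Lemma column_catr u cs1 cs2 : column u (cs1 ++ cs2) -> cs2 <> [::] -> column u cs2.
Proof.
elim: cs1 => //= c cs1 IH col ne.
by apply: IH => //; have [] := column_cons col (@cat_neq0 cs1 _ ne).
Qed.

(** Only the last cell of a run has its upper neighbour outside the run. This is where operation
    (iii) can lengthen an overlap. *)
Lemma column_catl u cs1 cs2 x : column u (cs1 ++ cs2) -> cs2 <> [::] -> x \in cs1 ->
  exists2 z, u x = Some z &
    z \in cs1 \/ z = head 0 cs2 /\ exists cs1', cs1 = rcons cs1' x.
Proof.
elim: cs1 => //= c cs1 IH col ne.
have [uc col'] := column_cons col (@cat_neq0 cs1 _ ne); rewrite in_cons.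
case/orP=> [/eqP->|xcs].
  exists (head 0 (cs1 ++ cs2)) => //; case: cs1 {IH col uc col'} => [|d cs1] /=.
    by right; split=> //; exists [::].
  by left; rewrite !in_cons eqxx orbT.
have [z uz] := IH col' ne xcs; case=> [zcs|[z_hd [cs1' cs1E]]]; exists z => //.
  by left; rewrite in_cons zcs orbT.
by right; split=> //; exists (c :: cs1'); rewrite cs1E.
Qed.

Lemma column_top u cs x : column u cs -> x \in cs -> u x = None ->
  exists cs', cs = rcons cs' x.
Proof.
elim: cs => //= c cs IH col; rewrite in_cons => /orP[/eqP->|xcs] ux.
  by case: cs col {IH} => [|d cs]; [exists [::] | rewrite ux; case].
case: cs xcs col IH => // d cs xcs [_ col] IH.
by have [cs' ->] := IH col xcs ux; exists (c :: cs').
Qed.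

Lemma column_succ u cs x z : column u cs -> x \in cs -> u x = Some z -> z \in cs.
Proof.
elim: cs => //= c cs IH col; rewrite !in_cons => /orP[/eqP->|xcs] ux.
  by case: cs col {IH} => [|d cs]; rewrite ux => //; case=> -[->]; rewrite in_cons eqxx orbT.
by case: cs xcs col IH => // d cs xcs [_ col] IH; rewrite (IH col) ?orbT.
Qed.

Lemma column_last u cs x : column u (rcons cs x) -> u x = None.
Proof. by rewrite -cats1 => /column_catr; apply. Qed.

Lemma column_map u u' (f : nat -> nat) cs :
  {in cs, forall x, u' (f x) = omap f (u x)} -> column u cs -> column u' (map f cs).
Proof.
elim: cs => //= c cs IH uu'; have ucc := uu' c (mem_head _ _).
have {}IH := IH (fun x xcs => uu' x (mem_behead (s := c :: cs) xcs)).
case: cs IH {uu'} => [|d cs] IH; first by rewrite ucc => ->.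
by move=> [uc col]; split; [rewrite ucc uc | apply: IH].
Qed.

Lemma column_morph u u' (f : nat -> nat) cs : column u cs -> column u' (map f cs) ->
  {in cs, forall x, u' (f x) = omap f (u x)}.
Proof.
elim: cs => //= c cs IH col col' x; rewrite in_cons => /orP[/eqP->|xcs].
  by case: cs col col' {IH} => [|d cs] /=; [move=> -> -> | case=> -> _ [-> _]].
by case: cs xcs col col' IH => // d cs xcs [_ col] [_ col'] IH; apply: IH.
Qed.

Lemma column_eq u u' cs : {in cs, u =1 u'} -> column u cs -> column u' cs.
Proof.
move=> uu' col; rewrite -(map_id cs); apply: column_map col => x /uu' <-.
by case: (u x).
Qed.

Lemma column_upd u cs x n : column u (rcons cs x) -> u n = None ->
  x \notin cs -> n != x -> column (upd u x (Some n)) (rcons (rcons cs x) n).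
Proof.
move=> + un + nx; elim: cs => [|c cs IH] /=.
  by rewrite /upd eqxx (negPf nx).
rewrite in_cons negb_or eq_sym => + /andP[xc xcs].
case: cs xcs IH => [|d cs] xcs IH [uc col].
  by split; [rewrite /upd (negPf xc) | apply: IH].
by split; [rewrite /upd (negPf xc) | apply: IH].
Qed.

Lemma column_inj u c cs cs' : column u (c :: cs) -> column u (c :: cs') -> cs = cs'.
Proof.
elim: cs c cs' => [|d cs IH] c [|d' cs'] //; first by move=> /= ->; case.
  by move=> [/= ->].
by move=> [uc col] [uc' col']; move: uc' col'; rewrite uc => -[<-] /(IH _ _ col) ->.
Qed.

Lemma count_column u cs : column u cs -> count (fun c => u c == None) cs = 1.
Proof.
elim: cs => // c [|d cs] IH; first by move=> /= ->.
by case=> uc col; rewrite -[LHS]/((u c == None) + count _ (d :: cs)) uc IH.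
Qed.

End Column.

(** * Cell listings described by a tree *)

Section Representation.
Implicit Types (u l : nat -> option nat) (cs s : seq nat) (T : ftree).

(** Here [ds] is the whole child column, [s0] its own descendants, and the run [cs] is glued in
    order to the k lowest cells of [ds]. The parameter [repD] allows the use inside the recursion of
    [rep]. *)
Definition attached u l (repD : seq nat -> seq nat -> Prop) k cs s : Prop :=
  exists ds s0, [/\ s = ds ++ s0, repD ds s0, column u ds,
    map l cs = map Some (take k ds) & 0 < k <= size ds].

(* [rep u l T cs s]: the gluing maps [u] (right upper) and [l] (right lower)
   make [cs] a column of shape [T], whose descendants outside [cs] are the cells
   [s]; [u] is not constrained on [cs] itself. *)
Fixpoint rep u l T cs s : Prop :=
  match T with
  | Leaf => exists c, [/\ cs = [:: c], s = [::] & l c = None]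
  | Cap D k => attached u l (rep u l D) k cs s
  | Free T => exists c cs', [/\ cs = c :: cs', l c = None & rep u l T cs' s]
  | Glue D k T => exists cs1 cs2 s1 s2, [/\ cs = cs1 ++ cs2, s = s1 ++ s2,
       attached u l (rep u l D) k cs1 s1 & rep u l T cs2 s2]
  end.

Lemma attached_size u l repD k cs s : attached u l repD k cs s -> size cs = k.
Proof.
move=> [ds [s0 [_ _ _ /(congr1 size) + /andP[_ le_k]]]].
by rewrite !size_map size_takel.
Qed.

Lemma attached_neq0 u l repD k cs s : attached u l repD k cs s -> cs <> [::].
Proof.
move=> att csE; have := attached_size att; move: att => [ds [s0 [_ _ _ _]]].
by rewrite csE => /andP[+ _] => /[swap] <-.
Qed.

Lemma rep_neq0 u l T cs s : rep u l T cs s -> cs <> [::].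
Proof.
case: T => [|D k|T|D k T] /=; first by move=> [c [-> _ _]].
- exact: attached_neq0.
- by move=> [c [cs' [->]]].
- by move=> [cs1 [cs2 [s1 [s2 [-> _ /attached_neq0 ne _]]]]]; case: cs1 ne.
Qed.

Lemma rep_height u l T cs s : rep u l T cs s -> size cs = height T.
Proof.
elim: T cs s => [|D _ k|T IH|D _ k T IH] cs s /=; first by move=> [c [-> _ _]].
- exact: attached_size.
- by move=> [c [cs' [-> _ /IH <-]]].
- move=> [cs1 [cs2 [s1 [s2 [-> _ /attached_size <- /IH <-]]]]].
  by rewrite size_cat.
Qed.

Lemma rep_valid u l T cs s : rep u l T cs s -> valid T.
Proof.
elim: T cs s => [//|D IHD k|T IH|D IHD k T IH] cs s /=.
- move=> [ds [s0 [_ rD _ _ le_k]]].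
  by rewrite (IHD _ _ rD) -(rep_height rD) le_k.
- by move=> [c [cs' [_ _ /IH]]].
- move=> [cs1 [cs2 [s1 [s2 [_ _ [ds [s0 [_ rD _ _ le_k]]] rT]]]]].
  by rewrite (IHD _ _ rD) (IH _ _ rT) -(rep_height rD) le_k.
Qed.

Lemma attached_some u l repD k cs s x : attached u l repD k cs s -> x \in cs ->
  exists2 z, l x = Some z & z \in s.
Proof.
move=> [ds [s0 [-> _ _ lcs _]]] xcs.
have : l x \in map Some (take k ds) by rewrite -lcs map_f.
by move=> /mapP[z /mem_take zds ->]; exists z; rewrite // mem_cat zds.
Qed.

Lemma rep_target u l T cs s x z :
  rep u l T cs s -> x \in cs ++ s -> l x = Some z -> z \in s.
Proof.
elim: T cs s => [|D IHD k|T IH|D IHD k T IH] cs s /=.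
- by move=> [c [-> -> lc]]; rewrite mem_seq1 => /eqP->; rewrite lc.
- move=> att; rewrite mem_cat => /orP[xcs lx|].
    by have [z' ] := attached_some att xcs; rewrite lx => -[->].
  by case: att => ds [s0 [-> rD _ _ _]] xs /(IHD _ _ rD xs); rewrite mem_cat orbC => ->.
- move=> [c [cs' [-> lc rT]]]; rewrite in_cons => /orP[/eqP->|]; first by rewrite lc.
  exact: IH.
- move=> [cs1 [cs2 [s1 [s2 [-> -> att rT]]]]]; rewrite !mem_cat => + lx.
  have attx : x \in s1 -> z \in s1.
    move: att => [ds [s0 [-> rD _ _ _]]] xs.
    by have := IHD _ _ rD xs lx; rewrite mem_cat orbC => ->.
  have IHx := IH _ _ rT; rewrite mem_cat in IHx.
  case/orP=> /orP[xs|xs].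
  + by have [z'] := attached_some att xs; rewrite lx => -[->] ->.
  + by rewrite IHx ?xs ?orbT.
  + by rewrite attx.
  + by rewrite IHx ?xs ?orbT.
Qed.

Lemma rep_map u l u' l' (f : nat -> nat) T cs s :
  {in cs ++ s, forall x, l' (f x) = omap f (l x)} ->
  {in s, forall x, u' (f x) = omap f (u x)} ->
  rep u l T cs s -> rep u' l' T (map f cs) (map f s).
Proof.
have att D k : (forall cs s,
  {in cs ++ s, forall x, l' (f x) = omap f (l x)} ->
  {in s, forall x, u' (f x) = omap f (u x)} ->
  rep u l D cs s -> rep u' l' D (map f cs) (map f s)) -> forall cs s,
  {in cs ++ s, forall x, l' (f x) = omap f (l x)} ->
  {in s, forall x, u' (f x) = omap f (u x)} ->
  attached u l (rep u l D) k cs s -> attached u' l' (rep u' l' D) k (map f cs) (map f s).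
  move=> IHD {}cs {}s hl hu [ds [s0 [sE rD col lcs le_k]]].
  exists (map f ds), (map f s0); split.
  - by rewrite sE map_cat.
  - apply: IHD => // x xs; [apply: hl | apply: hu]; rewrite sE !mem_cat.
      by rewrite -mem_cat xs orbT.
    by rewrite xs orbT.
  - by apply: column_map col => x xds; apply: hu; rewrite sE mem_cat xds.
  - rewrite -map_take.
    have -> e : map Some (map f e) = map (omap f) (map Some e) by rewrite -!map_comp.
    rewrite -lcs -!map_comp.
    by apply/eq_in_map => x xcs /=; rewrite hl // mem_cat xcs.
  - by rewrite size_map.
elim: T cs s => [|D IHD k|T IH|D IHD k T IH] cs s hl hu /=.
- move=> [c [csE -> lc]]; exists (f c); split=> //; first by rewrite csE.
  by rewrite hl ?lc // csE mem_head.
- exact: att.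
- move=> [c [cs' [csE lc rT]]]; exists (f c), (map f cs'); split.
  + by rewrite csE.
  + by rewrite hl ?lc // csE mem_head.
  + by apply: IH rT => // x xs; apply: hl; rewrite csE /= in_cons xs orbT.
- move=> [cs1 [cs2 [s1 [s2 [csE sE attD rT]]]]].
  exists (map f cs1), (map f cs2), (map f s1), (map f s2).
  split; rewrite ?csE ?sE ?map_cat //.
  + apply: (att _ _ IHD) attD => x xs; [apply: hl | apply: hu]; rewrite ?csE sE.
      by move: xs; rewrite !mem_cat => /orP[]->; rewrite ?orbT.
    by rewrite mem_cat xs.
  + apply: IH rT => x xs; [apply: hl | apply: hu]; rewrite ?csE sE.
      by move: xs; rewrite !mem_cat => /orP[]->; rewrite ?orbT.
    by rewrite mem_cat xs orbT.
Qed.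

Lemma rep_eq u l u' l' T cs s : {in cs ++ s, l =1 l'} -> {in s, u =1 u'} ->
  rep u l T cs s -> rep u' l' T cs s.
Proof.
move=> hl hu r; rewrite -(map_id cs) -(map_id s).
by apply: rep_map r => x xs; [rewrite -hl | rewrite -hu] => //; case: (_ x).
Qed.

(** Adds a free cell on top of the column: the former top item turns into its non-final
    counterpart. *)
Fixpoint append T :=
  match T with
  | Leaf => Free Leaf
  | Cap D k => Glue D k Leaf
  | Free T => Free (append T)
  | Glue D k T => Glue D k (append T)
  end.

Lemma rep_append u l T cs s n :
  l n = None -> rep u l T cs s -> rep u l (append T) (rcons cs n) s.
Proof.
move=> ln; elim: T cs s => [|D _ k|T IH|D _ k T IH] cs s /=.
- by move=> [c [-> -> lc]]; exists c, [:: n]; split=> //; exists n.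
- move=> att; exists cs, [:: n], s, [::]; rewrite cats1 cats0; split=> //.
  by exists n.
- move=> [c [cs' [-> lc rT]]]; exists c, (rcons cs' n); split=> //; exact: IH.
- move=> [cs1 [cs2 [s1 [s2 [-> -> att rT]]]]].
  by exists cs1, (rcons cs2 n), s1, s2; rewrite rcons_cat; split=> //; apply: IH.
Qed.

End Representation.

(** * The gluing maps determine the tree and the listing, and conversely *)

Section Determinism.
Implicit Types (u l : nat -> option nat) (cs s : seq nat) (T : ftree).

(** The first cell of the run is glued to the bottom of the child, from which [u] generates the
    whole column [ds]. *)
Lemma attached_inj u l D D' k k' cs s s' :
  (forall D' cs s s', rep u l D cs s -> rep u l D' cs s' ->
     uniq (cs ++ s) -> uniq (cs ++ s') -> D = D' /\ s = s') ->
  attached u l (rep u l D) k cs s -> attached u l (rep u l D') k' cs s' ->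
  uniq s -> uniq s' -> [/\ D = D', k = k' & s = s'].
Proof.
move=> IHD att att'; have kk' : k = k' by rewrite -(attached_size att) (attached_size att').
rewrite -{}kk' in att' *; have ne := attached_neq0 att.
move: att att' => [ds [s0 [-> rD col lcs /andP[k_gt0 _]]]] [ds' [s0' [-> rD' col' lcs' _]]].
have ds_eq : ds = ds'.
  move: lcs; rewrite lcs'; case: ds col {rD lcs'} => // d ds col.
  case: ds' col' {rD'} => // d' ds' col'; case: k k_gt0 => //= k _ [dE].
  by move: col'; rewrite dE => /(column_inj col) ->.
rewrite -ds_eq in rD' *; move=> us us'.
by have [-> ->] := IHD _ _ _ _ rD rD' us us'.
Qed.

(** A run cannot be cut in two: [c] would be glued to a cell of the child met by [cs1], in [s1], and
    also to a cell of [s2]. *)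
Lemma attached_maximal u l repD repD' k k' cs1 c cs2 s s1 T cs3 s2 :
  attached u l repD k (cs1 ++ c :: cs2) s -> attached u l repD' k' cs1 s1 ->
  rep u l T (c :: cs3) s2 -> ~~ has (mem s1) s2 -> False.
Proof.
move=> att att' rT; have ne := attached_neq0 att'; have size1 := attached_size att'.
move: att att' => [ds [s0 [_ _ col lcs /andP[k_gt0 _]]]].
move=> [ds' [s0' [-> _ col' lcs' /andP[k'_gt0 _]]]] /negP disj.
have ds_eq : ds = ds'.
  move: lcs lcs'; case: ds col => // d ds col.
  case: ds' col' {disj} => // d' ds' col'; case: k k_gt0 => //= k _.
  case: k' k'_gt0 size1 => //= k' _ _; case: cs1 ne => //= c1 cs1 _ [-> _] [dE _].
  by move: col'; rewrite -dE => /(column_inj col) ->.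
have : l c \in map Some (take k ds) by rewrite -lcs map_f // mem_cat mem_head orbT.
move=> /mapP[z /mem_take zds lc].
apply: disj; apply/hasP; exists z; first by apply: (rep_target rT) lc; rewrite mem_head.
by rewrite /= mem_cat -ds_eq zds.
Qed.

Lemma cat_eq_prefix (cs1 cs2 cs1' cs2' : seq nat) :
  cs1 ++ cs2 = cs1' ++ cs2' -> size cs1 < size cs1' ->
  exists c x y, cs1' = cs1 ++ c :: x /\ cs2 = c :: y.
Proof.
move=> eq_cs lt_size; have := congr1 (take (size cs1')) eq_cs.
rewrite [RHS]take_size_cat // take_cat ltnNge (ltnW lt_size) /=.
case: cs2 eq_cs => [|c y] eq_cs.
  by move: (congr1 size eq_cs); rewrite !size_cat /=; lia.
move: lt_size; rewrite -subn_gt0; case: (_ - _) => //= m _ <-.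
by exists c, (take m y), y.
Qed.

(** The bottom cell tells a free item from a glued one, and [attached_maximal] fixes the length of a
    glued run. *)
Lemma rep_inj u l T T' cs s s' : rep u l T cs s -> rep u l T' cs s' ->
  uniq (cs ++ s) -> uniq (cs ++ s') -> T = T' /\ s = s'.
Proof.
elim: T T' cs s s' => [|D IHD k|T IH|D IHD k T IH] T' cs s s' /=.
- move=> [c [-> -> lc]] rT' _ _; case: T' rT' => [|D k|T|D k T] /=.
  + by move=> [c' [_ -> _]].
  + by move=> att; have [|z] := attached_some (x := c) att; rewrite ?mem_head // lc.
  + by move=> [c' [cs' [[_ <-] _ /rep_neq0]]].
  + move=> [cs1 [cs2 [s1 [s2 [csE _ att _]]]]].
    have cE : c = head 0 cs1.
      by have := attached_neq0 att; case: cs1 {att} csE => //= c1 cs1 [->].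
    have [|z] := attached_some (x := c) att; last by rewrite lc.
    by have := attached_neq0 att; rewrite cE; case: cs1 {att csE cE} => //= *; rewrite mem_head.
- move=> att; case: T' => [|D' k'|T'|D' k' T'] /=.
  + move=> [c [csE _ lc]].
    by have [|z] := attached_some (x := c) att; rewrite ?csE ?mem_head // lc.
  + move=> att' us us'.
    have [||-> -> ->] // := attached_inj IHD att att'.
      by move: us; rewrite cat_uniq => /and3P[].
    by move: us'; rewrite cat_uniq => /and3P[].
  + move=> [c [cs' [csE lc _]]].
    by have [|z] := attached_some (x := c) att; rewrite ?csE ?mem_head // lc.
  + move=> [cs1 [cs2 [s1 [s2 [csE sE att' rT']]]]] us us'.
    have := rep_neq0 rT'; case: cs2 csE rT' => // c cs2 csE rT' _.
    rewrite csE in att; case: (attached_maximal att att' rT').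
    by move: us'; rewrite sE !cat_uniq => /and3P[_ _ /and3P[]].
- move=> [c [cs' [-> lc rT]]] rT' us us'; case: T' rT' => [|D k|T'|D k T'] /=.
  + by move=> [c' [[_ csE] _ _]]; case: (rep_neq0 rT).
  + by move=> att; have [|z] := attached_some (x := c) att; rewrite ?mem_head // lc.
  + move=> [c' [cs'' [[_ <-] _ rT']]].
    by have [||-> ->] // := IH _ _ _ _ rT rT'; [case/andP: us | case/andP: us'].
  + move=> [cs1 [cs2 [s1 [s2 [csE _ att _]]]]].
    have [|z] := attached_some (x := c) att; last by rewrite lc.
    by have := attached_neq0 att; case: cs1 {att} csE => //= c1 cs1 [-> _] _; rewrite mem_head.
- move=> [cs1 [cs2 [s1 [s2 [csE sE att rT]]]]]; case: T' => [|D' k'|T'|D' k' T'] /=.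
  + move=> [c [csE' _ lc]]; move: csE; rewrite csE' => csE.
    have [|z] := attached_some (x := c) att; last by rewrite lc.
    by have := attached_neq0 att; case: cs1 {att} csE => //= c1 cs1 [-> _] _; rewrite mem_head.
  + move=> att' us us'.
    have := rep_neq0 rT; case: cs2 csE rT => // c cs2 csE rT _.
    rewrite csE in att'; case: (attached_maximal att' att rT).
    by move: us; rewrite sE !cat_uniq => /and3P[_ _ /and3P[]].
  + move=> [c [cs' [csE' lc _]]]; move: csE; rewrite csE' => csE.
    have [|z] := attached_some (x := c) att; last by rewrite lc.
    by have := attached_neq0 att; case: cs1 {att} csE => //= c1 cs1 [-> _] _; rewrite mem_head.
  + move=> [cs1' [cs2' [s1' [s2' [csE' sE' att' rT']]]]] us us'.
    have := us; rewrite sE !cat_uniq => /and3P[_ _ /and3P[us1 disj us2]].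
    have := us'; rewrite sE' !cat_uniq => /and3P[_ _ /and3P[us1' disj' us2']].
    have eq_cs : cs1 ++ cs2 = cs1' ++ cs2' by rewrite -csE.
    case: (ltngtP (size cs1) (size cs1')) => [lt_s|lt_s|eq_s].
    * have [c [x [z [cs1E cs2E]]]] := cat_eq_prefix eq_cs lt_s.
      rewrite cs1E in att'; rewrite cs2E in rT.
      by case: (attached_maximal att' att rT).
    * have [c [x [z [cs1E cs2E]]]] := cat_eq_prefix (esym eq_cs) lt_s.
      rewrite cs1E in att; rewrite cs2E in rT'.
      by case: (attached_maximal att att' rT').
    * move/eqP: eq_cs; rewrite eqseq_cat // => /andP[/eqP cs1E /eqP cs2E].
      rewrite -cs1E in att'; rewrite -cs2E in rT'.
      have [-> -> ->] := attached_inj IHD att att' us1 us1'.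
      have [||-> ->] // := IH _ _ _ _ rT rT'.
        apply: subseq_uniq us; rewrite csE sE.
        by apply: cat_subseq; exact: suffix_subseq.
      apply: subseq_uniq us'; rewrite csE sE'.
      by apply: cat_subseq; exact: suffix_subseq.
Qed.

Fixpoint others T :=
  match T with
  | Leaf => 0
  | Cap D _ => height D + others D
  | Free T => others T
  | Glue D _ T => height D + others D + others T
  end.

Lemma rep_others u l T cs s : rep u l T cs s -> size s = others T.
Proof.
elim: T cs s => [|D IHD k|T IH|D IHD k T IH] cs s /=; first by move=> [c [_ -> _]].
- by move=> [ds [s0 [-> rD _ _ _]]]; rewrite size_cat (rep_height rD) (IHD _ _ rD).
- by move=> [c [cs' [_ _ rT]]]; rewrite (IH _ _ rT).
- move=> [cs1 [cs2 [s1 [s2 [_ -> [ds [s0 [-> rD _ _ _]]] rT]]]]].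
  by rewrite !size_cat (rep_height rD) (IHD _ _ rD) (IH _ _ rT).
Qed.

(** Converse of [rep_map]. The pieces of both listings are matched by size, which depends on the
    tree alone. *)
Lemma rep_morph u l u' l' (f : nat -> nat) T cs s :
  rep u l T cs s -> rep u' l' T (map f cs) (map f s) ->
  {in cs ++ s, forall x, l' (f x) = omap f (l x)} /\
  {in s, forall x, u' (f x) = omap f (u x)}.
Proof.
have att D k : (forall cs s, rep u l D cs s -> rep u' l' D (map f cs) (map f s) ->
    {in cs ++ s, forall x, l' (f x) = omap f (l x)} /\
    {in s, forall x, u' (f x) = omap f (u x)}) -> forall cs s,
    attached u l (rep u l D) k cs s ->
    attached u' l' (rep u' l' D) k (map f cs) (map f s) ->
    {in cs ++ s, forall x, l' (f x) = omap f (l x)} /\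
    {in s, forall x, u' (f x) = omap f (u x)}.
  move=> IHD {}cs {}s [ds [s0 [-> rD col lcs _]]] [ds' [s0' [sE rD' col' lcs' _]]].
  move/eqP: sE; rewrite map_cat eqseq_cat; last first.
    by rewrite size_map (rep_height rD) (rep_height rD').
  move=> /andP[/eqP dsE /eqP s0E]; rewrite -dsE -s0E in rD' col' lcs'.
  have [hl hu] := IHD _ _ rD rD'; split=> x; rewrite !mem_cat.
    case/orP=> [xcs|xs]; last by apply: hl; rewrite mem_cat.
    move: x xcs; apply/eq_in_map; rewrite map_comp lcs' -map_take.
    by rewrite (map_comp (omap f)) lcs -!map_comp.
  case/orP=> [xds|]; last exact: hu.
  exact: (column_morph col col').
elim: T cs s => [|D IHD k|T IH|D IHD k T IH] cs s /=.
- move=> [c [-> -> lc]] [c' [[<-] _ lc']]; split=> // x; rewrite mem_seq1 => /eqP->.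
  by rewrite lc lc'.
- exact: att.
- move=> [c [cs' [-> lc rT]]] [c' [cs'' [[<- <-] lc' rT']]].
  have [hl hu] := IH _ _ rT rT'; split=> // x; rewrite in_cons => /orP[/eqP->|]; last exact: hl.
  by rewrite lc lc'.
- move=> [cs1 [cs2 [s1 [s2 [-> -> attD rT]]]]] [cs1' [cs2' [s1' [s2' [csE sE attD' rT']]]]].
  move/eqP: csE; rewrite map_cat eqseq_cat; last first.
    by rewrite size_map (attached_size attD) (attached_size attD').
  move=> /andP[/eqP cs1E /eqP cs2E]; rewrite -cs1E -cs2E in attD' rT'.
  have eq_s : size (map f s1) = size s1'.
    move: attD attD' => [ds [s0 [-> rD _ _ _]]] [ds' [s0' [-> rD' _ _ _]]].
    by rewrite size_map !size_cat !(rep_height rD, rep_height rD', rep_others rD, rep_others rD').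
  move/eqP: sE; rewrite map_cat eqseq_cat // => /andP[/eqP s1E /eqP s2E].
  rewrite -s1E -s2E in attD' rT'.
  have [hl1 hu1] := att _ _ IHD _ _ attD attD'; have [hl2 hu2] := IH _ _ rT rT'.
  split=> x; rewrite !mem_cat => h.
    have := hl1 x; have := hl2 x; rewrite !mem_cat.
    by move: h => /orP[/orP[]|/orP[]] ->; rewrite ?orbT => // *; auto.
  by case/orP: h; [exact: hu1 | exact: hu2].
Qed.
End Determinism.

(** * Adding a cell *)

Section Growth.
Variables (u l : nat -> option nat) (n : nat).
Hypotheses (un : u n = None) (ln : l n = None).
Implicit Types (cs ds s : seq nat) (T D : ftree).

Lemma updE (f : nat -> option nat) x v z : z != x -> upd f x v z = f z.
Proof. by rewrite /upd => /negPf->. Qed.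

Lemma upd_same (f : nat -> option nat) x v : upd f x v x = v.
Proof. by rewrite /upd eqxx. Qed.

Lemma upd_eq (f : nat -> option nat) x v s : x \notin s -> {in s, f =1 upd f x v}.
Proof. by move=> xs z zs; rewrite updE //; apply: contraNneq xs => <-. Qed.

Lemma perm_new ds s0 : perm_eq (ds ++ n :: s0) (n :: ds ++ s0).
Proof. by rewrite -[n :: s0]cat1s perm_catCA. Qed.

Lemma perm_new_catr ds s s' : perm_eq s' (n :: s) -> perm_eq (ds ++ s') (n :: ds ++ s).
Proof. by move=> p; apply: perm_trans (perm_new ds s); rewrite perm_cat2l. Qed.

Lemma perm_new_catl s0 s s' : perm_eq s' (n :: s) -> perm_eq (s' ++ s0) (n :: s ++ s0).
Proof. by move=> p; rewrite -cat_cons perm_cat2r. Qed.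

Lemma notin_cat (s1 s2 : seq nat) x : x \notin s1 ++ s2 -> x \notin s1 /\ x \notin s2.
Proof. by rewrite mem_cat negb_or => /andP. Qed.

Lemma uniq_catP (s1 s2 : seq nat) : uniq (s1 ++ s2) ->
  [/\ uniq s1, uniq s2, {in s1, forall x, x \notin s2} & {in s2, forall x, x \notin s1}].
Proof.
rewrite cat_uniq => /and3P[u1 /hasPn disj u2]; split=> // x.
by move=> x1; apply/negP => /disj; rewrite /= x1.
Qed.

(** A cell with free right upper edge is the top of its column, which grows by [append]. The new
    cell enters in the middle of the listing, hence the permutation. *)
Lemma rep_op1 x T cs s : rep u l T cs s -> uniq s -> n \notin s -> x \in s -> u x = None ->
  exists T' s', rep (upd u x (Some n)) l T' cs s' /\ perm_eq s' (n :: s).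
Proof.
move=> + + + + ux; set u' := upd u x (Some n).
have att D k : (forall cs s, rep u l D cs s -> uniq s -> n \notin s -> x \in s ->
    exists T' s', rep u' l T' cs s' /\ perm_eq s' (n :: s)) ->
  forall cs s, attached u l (rep u l D) k cs s -> uniq s -> n \notin s -> x \in s ->
    exists D' s', attached u' l (rep u' l D') k cs s' /\ perm_eq s' (n :: s).
  move=> IHD {}cs {}s [ds [s0 [-> rD col lcs /andP[k_gt0 le_k]]]].
  move=> /uniq_catP[uds us0 disj disj'] /notin_cat[nds ns0].
  rewrite mem_cat; case: (boolP (x \in ds)) => [xds _|xds /= xs0].
    have [ds0 dsE] := column_top col xds ux.
    exists (append D), (rcons ds n ++ s0); split; last first.
      by rewrite cat_rcons; apply: perm_new.
    exists (rcons ds n), s0; split=> //.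
    - apply: rep_append => //; apply: rep_eq rD => //; by apply: upd_eq; exact: disj.
    - rewrite /u' {1}dsE; apply: column_upd; rewrite -?dsE //.
        by move: uds; rewrite dsE rcons_uniq => /andP[].
      by apply: contraNneq nds => ->.
    - by rewrite -cats1 takel_cat.
    - by rewrite size_rcons k_gt0 ltnW.
  have [D' [s0' [rD' p]]] := IHD _ _ rD us0 ns0 xs0.
  exists D', (ds ++ s0'); split; last exact: perm_new_catr.
  exists ds, s0'; split=> //; last by rewrite k_gt0.
  by apply: column_eq col; apply: upd_eq.
elim: T cs s => [|D IHD k|T IH|D IHD k T IH] cs s /=.
- by move=> [c [_ -> _]].
- move=> rD us ns xs; have [D' [s' [rD' p]]] := att _ _ IHD _ _ rD us ns xs.
  by exists (Cap D' k), s'.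
- move=> [c [cs' [-> lc rT]]] us ns xs; have [T' [s' [rT' p]]] := IH _ _ rT us ns xs.
  by exists (Free T'), s'; split=> //; exists c, cs'.
- move=> [cs1 [cs2 [s1 [s2 [-> -> attD rT]]]]] /uniq_catP[us1 us2 disj disj'].
  move=> /notin_cat[ns1 ns2]; rewrite mem_cat; case: (boolP (x \in s1)) => [xs1 _|xs1 /= xs2].
    have [D' [s1' [attD' p]]] := att _ _ IHD _ _ attD us1 ns1 xs1.
    exists (Glue D' k T), (s1' ++ s2); split; last exact: perm_new_catl.
    exists cs1, cs2, s1', s2; split=> //; apply: rep_eq rT => //; by apply: upd_eq; exact: disj.
  have [T' [s2' [rT' p]]] := IH _ _ rT us2 ns2 xs2.
  exists (Glue D k T'), (s1 ++ s2'); split; last exact: perm_new_catr.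
  exists cs1, cs2, s1, s2'; split=> //.
  by apply: (rep_eq (T := Cap D k)) attD => //; exact: upd_eq.
Qed.

(** The free item of [x] becomes a run of length 1 glued to a new column of height 1: [Leaf] turns
    into [Cap Leaf 1], [Free] into [Glue Leaf 1]. *)
Lemma rep_op2 x T cs s : rep u l T cs s -> uniq (cs ++ s) -> n \notin cs ++ s ->
    x \in cs ++ s -> l x = None ->
  exists T' s', rep u (upd l x (Some n)) T' cs s' /\ perm_eq s' (n :: s).
Proof.
move=> + + + + lx; set l' := upd l x (Some n).
have att D k : (forall cs s, rep u l D cs s -> uniq (cs ++ s) -> n \notin cs ++ s ->
    x \in cs ++ s -> exists T' s', rep u l' T' cs s' /\ perm_eq s' (n :: s)) ->
  forall cs s, attached u l (rep u l D) k cs s -> uniq (cs ++ s) -> n \notin s -> x \in s ->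
    exists D' s', attached u l' (rep u l' D') k cs s' /\ perm_eq s' (n :: s).
  move=> IHD {}cs {}s [ds [s0 [-> rD col lcs le_k]]] /uniq_catP[_ us _ disj] ns xs.
  have [D' [s0' [rD' p]]] := IHD _ _ rD us ns xs.
  exists D', (ds ++ s0'); split; last exact: perm_new_catr.
  exists ds, s0'; split=> //; rewrite -lcs; apply/eq_in_map => z zcs.
  by rewrite /l' -(upd_eq _ _ (disj _ xs)).
have new : n != x -> attached u l' (rep u l' Leaf) 1 [:: x] [:: n].
  move=> nx; exists [:: n], [::]; split=> //; last by rewrite /= /l' upd_same.
  by exists n; rewrite /l' updE.
elim: T cs s => [|D IHD k|T IH|D IHD k T IH] cs s /=.
- move=> [c [-> -> lc]] _; rewrite !mem_seq1 => nc /eqP xc.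
  by exists (Cap Leaf 1), [:: n]; split=> //; rewrite -xc; apply: new; rewrite xc.
- move=> rD us /notin_cat[ncs ns]; rewrite mem_cat; case: (boolP (x \in cs)) => [xcs|_ /= xs].
    by have [z] := attached_some rD xcs; rewrite lx.
  have [D' [s' [rD' p]]] := att _ _ IHD _ _ rD us ns xs.
  by exists (Cap D' k), s'.
- move=> [c [cs' [-> lc rT]]] /= /andP[ccs us]; rewrite !in_cons negb_or => /andP[nc ns].
  case: (eqVneq x c) => [xc _|xc /= xs].
    exists (Glue Leaf 1 T), (n :: s); split=> //; exists [:: c], cs', [:: n], s; split=> //.
      by rewrite -xc; apply: new; rewrite xc.
    by apply: rep_eq rT => //; apply: upd_eq; rewrite xc.
  have [T' [s' [rT' p]]] := IH _ _ rT us ns xs.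
  exists (Free T'), s'; split=> //; exists c, cs'; split=> //.
  by rewrite /l' updE // eq_sym.
- move=> [cs1 [cs2 [s1 [s2 [-> -> attD rT]]]]] us.
  have us1 : uniq (cs1 ++ s1).
    by apply: subseq_uniq us; apply: cat_subseq; exact: prefix_subseq.
  have us2 : uniq (cs2 ++ s2).
    by apply: subseq_uniq us; apply: cat_subseq; exact: suffix_subseq.
  rewrite !mem_cat !negb_or => /andP[/andP[nc1 nc2] /andP[ns1 ns2]] xin.
  have [x1|x2] : x \in s1 \/ x \in cs2 ++ s2.
    rewrite mem_cat; move: xin => /orP[/orP[xs|->]|/orP[->|->]]; rewrite ?orbT; auto.
    by have [z] := attached_some attD xs; rewrite lx.
    have [D' [s1' [attD' p]]] := att _ _ IHD _ _ attD us1 ns1 x1.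
    exists (Glue D' k T), (s1' ++ s2); split; last exact: perm_new_catl.
    exists cs1, cs2, s1', s2; split=> //; apply: rep_eq rT => //; apply: upd_eq.
    have /uniq_catP[_ /uniq_catP[_ _ + _] _ +] := us.
    move=> /(_ _ x1) xs2 /(_ x); rewrite !mem_cat x1 negb_or => /(_ isT) /andP[_].
    by rewrite negb_or => ->.
  have ns2' : n \notin cs2 ++ s2 by rewrite mem_cat negb_or nc2.
  have [T' [s2' [rT' p]]] := IH _ _ rT us2 ns2' x2.
  exists (Glue D k T'), (s1 ++ s2'); split; last exact: perm_new_catr.
  exists cs1, cs2, s1, s2'; split=> //.
  apply: (rep_eq (T := Cap D k)) attD => //; apply: upd_eq.
  have : uniq ((cs1 ++ s1) ++ (cs2 ++ s2)).
    by rewrite (perm_uniq (permEl (perm_catACA cs1 s1 cs2 s2))).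
  by move=> /uniq_catP[_ _ _]; apply.
Qed.

Lemma rep_up x y T cs s : rep u l T cs s -> x \in s -> u x = Some y -> y \in s.
Proof.
move=> + + ux; elim: T cs s => [|D IHD k|T IH|D IHD k T IH] cs s /=.
- by move=> [c [_ -> _]].
- move=> [ds [s0 [-> rD col _ _]]]; rewrite !mem_cat => /orP[xds|xs].
    by rewrite (column_succ col xds).
  by rewrite (IHD _ _ rD) ?orbT.
- by move=> [c [cs' [_ _ /IH]]].
- move=> [cs1 [cs2 [s1 [s2 [_ -> [ds [s0 [-> rD col _ _]]] rT]]]]].
  rewrite !mem_cat => /orP[/orP[xds|xs]|xs].
  + by rewrite (column_succ col xds).
  + by rewrite (IHD _ _ rD) ?orbT.
  + by rewrite (IH _ _ rT) ?orbT.
Qed.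

(** A child column grows by one cell and its overlap by one, absorbing the free cell [y] just above
    the run. [column u cs] is assumed because [y] is found through [u] on [cs]. *)
Lemma rep_op3 x y z T cs s : rep u l T cs s -> column u cs -> uniq (cs ++ s) ->
    n \notin cs ++ s -> x \in cs ++ s -> u x = Some y -> l x = Some z ->
    l y = None -> u z = None ->
  exists T' s', rep (upd u z (Some n)) (upd l y (Some n)) T' cs s' /\ perm_eq s' (n :: s).
Proof.
move=> + + + + + ux lx ly uz; set u' := upd u _ _; set l' := upd l _ _.
have att D k : (forall cs s, rep u l D cs s -> column u cs -> uniq (cs ++ s) ->
    n \notin cs ++ s -> x \in cs ++ s ->
    exists T' s', rep u' l' T' cs s' /\ perm_eq s' (n :: s)) ->
  forall cs s, attached u l (rep u l D) k cs s -> uniq (cs ++ s) -> n \notin s -> x \in s ->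
    exists D' s', attached u' l' (rep u' l' D') k cs s' /\ perm_eq s' (n :: s).
  move=> IHD {}cs {}s attD us ns xs.
  have ys : y \in s by apply: (rep_up (T := Cap D k) attD xs).
  move: attD us ns xs ys => [ds [s0 [-> rD col lcs le_k]]] /uniq_catP[_ us _ disj] ns xs ys.
  have [D' [s0' [rD' p]]] := IHD _ _ rD col us ns xs.
  exists D', (ds ++ s0'); split; last exact: perm_new_catr.
  exists ds, s0'; split=> //.
    have zs0 := rep_target rD xs lx; apply: column_eq col; apply: upd_eq.
    by have /uniq_catP[_ _ _] := us; apply.
  rewrite -lcs; apply/eq_in_map => w wcs.
  by rewrite /l' -(upd_eq _ _ (disj _ ys)).
elim: T cs s => [|D IHD k|T IH|D IHD k T IH] cs s /=.
- by move=> [c [-> -> lc]] _ _ _; rewrite mem_seq1 => /eqP xc; move: lx; rewrite xc lc.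
- move=> rD col us /notin_cat[ncs ns]; rewrite mem_cat; case: (boolP (x \in cs)) => [xcs|_ /= xs].
    have ycs := column_succ col xcs ux.
    by have [w] := attached_some rD ycs; rewrite ly.
  have [D' [s' [rD' p]]] := att _ _ IHD _ _ rD us ns xs.
  by exists (Cap D' k), s'.
- move=> [c [cs' [-> lc rT]]] col /= /andP[ccs us]; rewrite !in_cons negb_or => /andP[nc ns].
  have xc : x != c by apply: contra_eq_neq lx => ->; rewrite lc.
  rewrite (negPf xc) /= => xs; have [_ col'] := column_cons col (rep_neq0 rT).
  have [T' [s' [rT' p]]] := IH _ _ rT col' us ns xs.
  exists (Free T'), s'; split=> //; exists c, cs'; split=> //.
  rewrite /l' updE //; apply: contraNneq ccs => ->; move: xs; rewrite !mem_cat => /orP[xcs|xs].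
    by rewrite (column_succ col' xcs ux).
  by rewrite (rep_up rT xs ux) orbT.
- move=> [cs1 [cs2 [s1 [s2 [-> -> attD rT]]]]] col us.
  have us1 : uniq (cs1 ++ s1).
    by apply: subseq_uniq us; apply: cat_subseq; exact: prefix_subseq.
  have us2 : uniq (cs2 ++ s2).
    by apply: subseq_uniq us; apply: cat_subseq; exact: suffix_subseq.
  have us12 : uniq ((cs1 ++ s1) ++ (cs2 ++ s2)).
    by rewrite (perm_uniq (permEl (perm_catACA cs1 s1 cs2 s2))).
  rewrite !mem_cat !negb_or => /andP[/andP[nc1 nc2] /andP[ns1 ns2]] xin.
  have ns2' : n \notin cs2 ++ s2 by rewrite mem_cat negb_or nc2.
  have col2 := column_catr col (rep_neq0 rT).
  have [x1|[x2|x1]] : x \in s1 \/ x \in cs2 ++ s2 \/ x \in cs1.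
    by rewrite mem_cat; move: xin => /orP[/orP[->|->]|/orP[->|->]]; rewrite ?orbT; auto.
  + have [D' [s1' [attD' p]]] := att _ _ IHD _ _ attD us1 ns1 x1.
    exists (Glue D' k T), (s1' ++ s2); split; last exact: perm_new_catl.
    have y1 := rep_up (T := Cap D k) attD x1 ux.
    have z1 : z \in s1.
      by apply: (rep_target (T := Cap D k) attD) lx; rewrite mem_cat x1 orbT.
    have /uniq_catP[_ _ disj _] := us12.
    exists cs1, cs2, s1', s2; split=> //; apply: rep_eq rT; apply: upd_eq.
      by apply: disj; rewrite mem_cat y1 orbT.
    by have /disj/notin_cat[] : z \in cs1 ++ s1 by rewrite mem_cat z1 orbT.
  + have [T' [s2' [rT' p]]] := IH _ _ rT col2 us2 ns2' x2.
    exists (Glue D k T'), (s1 ++ s2'); split; last exact: perm_new_catr.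
    have y2 : y \in cs2 ++ s2.
      move: x2; rewrite !mem_cat => /orP[x2|x2].
        by rewrite (column_succ col2 x2 ux).
      by rewrite (rep_up rT x2 ux) orbT.
    have z2 : z \in cs2 ++ s2 by rewrite mem_cat (rep_target rT x2 lx) orbT.
    have /uniq_catP[_ _ _ disj] := us12.
    exists cs1, cs2, s1, s2'; split=> //.
    apply: (rep_eq (T := Cap D k)) attD; apply: upd_eq; first exact: disj.
    by have /notin_cat[] := disj _ z2.
  + (* The new cell completes a square: [x] is the last cell of [cs1], [z] the top of
       the child column, and [y] the first cell of [cs2]. *)
    have [w] := column_catl col (rep_neq0 rT) x1; rewrite ux => -[<-].
    case=> [y1|[y_hd [cs1' cs1E]]]; first by have [v] := attached_some attD y1; rewrite ly.
    move: y_hd rT us us12 col2 ns2' nc2 {us2 IH xin}; case: cs2 col => [|y' cs2].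
      by move=> _ _ /rep_neq0.
    move=> col y_hd rT us us12 col2 ns2' nc2; rewrite /= in y_hd; subst y'.
    have := attD; move=> [ds [s0 [s1E rD colD lcs /andP[k_gt0 le_k]]]].
    (* [z] is glued to the last cell of the run and has a free upper edge: the overlap already
       reaches the top of the child, so k is its height. *)
    have dsE : ds = take k ds /\ exists ds', ds = rcons ds' z.
      have size_take1 : 0 < size (take k ds) by rewrite size_takel.
      move: lcs; rewrite cs1E map_rcons; case/lastP: (take k ds) (cat_take_drop k ds) size_take1 => //.
      move=> e w' dsE _; rewrite map_rcons => /rcons_inj[_ wE].
      move: wE; rewrite lx => -[wE]; rewrite -wE in dsE.
      have drop0 : drop k ds = [::].
        case: (drop k ds) dsE => // v vs dsE; move: colD; rewrite -dsE.
        by move=> colD'; have [||v'] := column_catl (x := z) colD'; rewrite ?mem_rcons ?mem_head ?uz.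
      by rewrite drop0 cats0 in dsE; rewrite -{1}dsE -wE; split=> //; exists e.
    have [takeE [ds' dsE']] := dsE; rewrite -takeE in lcs.
    have kE : k = size ds by rewrite [in RHS]takeE size_takel.
    have zds : z \in ds by rewrite dsE' mem_rcons mem_head.
    have /uniq_catP[us1' _ disj1 disj2] := us12.
    have us10 : uniq (ds ++ s0) by rewrite -s1E; case/uniq_catP: us1'.
    have /uniq_catP[uds _ disj0 _] := us10.
    have y_cs1s1 : y \notin cs1 ++ s1 by apply: disj2; rewrite mem_head.
    have [ycs1 ys1] := notin_cat y_cs1s1.
    have [nds ns0] : n \notin ds /\ n \notin s0 by apply: notin_cat; rewrite -s1E.
    have ny : n != y by move: nc2; rewrite in_cons negb_or => /andP[].
    have attD' : attached u' l' (rep u' l' (append D)) k.+1 (rcons cs1 y) (rcons ds n ++ s0).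
      exists (rcons ds n), s0; split=> //.
      + apply: rep_append; first by rewrite /l' updE.
        apply: rep_eq rD; apply: upd_eq; last exact: disj0.
        by rewrite -s1E.
      + rewrite /u' {1}dsE'; apply: column_upd; rewrite -?dsE' //.
          by move: uds; rewrite dsE' rcons_uniq => /andP[].
        by apply: contraNneq nds => ->.
      + rewrite take_oversize ?size_rcons ?kE // !map_rcons -lcs /l' upd_same.
        by congr rcons; apply/esym/eq_in_map; apply: upd_eq.
      + by rewrite size_rcons kE ltnSn.
    have perm1 : perm_eq (rcons ds n ++ s0) (n :: s1).
      by rewrite cat_rcons s1E; apply: perm_new.
    (* The right lower edge of [y] being free, T starts with [Leaf] or [Free]; that item joins the
       run. *)
    case: T rT => [|D2 k2|T2|D2 k2 T2] /= rT.
    * case: rT => c [[_ ->] -> _]; exists (Cap (append D) k.+1), (rcons ds n ++ s0).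
      rewrite cats0 cats1.
      by split.
    * by have [|v] := attached_some rT (x := y); rewrite ?mem_head ?ly.
    * case: rT => c [cs2' [[<- cs2E] _ rT]]; rewrite -{}cs2E in rT *.
      exists (Glue (append D) k.+1 T2), ((rcons ds n ++ s0) ++ s2); split; last first.
        exact: perm_new_catl.
      exists (rcons cs1 y), cs2, (rcons ds n ++ s0), s2; split=> //; first by rewrite cat_rcons.
      apply: rep_eq rT; apply: upd_eq.
        by have /uniq_catP[_ + _ _] := us12; case/andP.
      have /disj1 : z \in cs1 ++ s1 by rewrite mem_cat s1E mem_cat zds orbT.
      by case/notin_cat.
    * case: rT => c1 [c2 [t1 [t2 [csE _ att2 _]]]].
      have [|v] := attached_some att2 (x := y); last by rewrite ly.
      by have := attached_neq0 att2; case: c1 csE {att2} => //= c c1 [-> _] _; rewrite mem_head.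
Qed.

End Growth.

(** * From fish to trees *)

Section Fish.
Implicit Types (F G : prefish) (T D : ftree) (cs ds s : seq nat).

Definition glued F i j := ru F i = Some j \/ rl F i = Some j.

(** Invariants of the construction. The head is the only cell that is never a target, hence fixed by
    isomorphisms; injectivity of [ru] serves to count free left lower edges. *)
Definition well_glued F :=
  [/\ 0 < ncells F,
      forall i j, glued F i j -> i < ncells F /\ 0 < j < ncells F,
      forall j, 0 < j < ncells F -> exists i, glued F i j
    & forall i j k, ru F i = Some k -> ru F j = Some k -> i = j].

Lemma updP (f : nat -> option nat) x v i j :
  upd f x (Some v) i = Some j -> f i = Some j \/ i = x /\ j = v.
Proof. by rewrite /upd; case: eqP => [-> [<-]|_]; auto. Qed.

Lemma upd_mono (f : nat -> option nat) x v i j :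
  f x = None -> f i = Some j -> upd f x v i = Some j.
Proof. by move=> fx fi; rewrite updE //; apply: contra_eq_neq fi => ->; rewrite fx. Qed.

Lemma well_glued_step F u l : well_glued F -> let n := ncells F in
    (forall i j, u i = Some j -> ru F i = Some j \/ i < n /\ j = n) ->
    (forall i j, l i = Some j -> rl F i = Some j \/ i < n /\ j = n) ->
    (forall i j, ru F i = Some j -> u i = Some j) ->
    (forall i j, rl F i = Some j -> l i = Some j) ->
    (exists i, u i = Some n \/ l i = Some n) ->
    (forall i j, u i = Some n -> u j = Some n -> i = j) ->
  well_glued (PreFish n.+1 u l).
Proof.
move=> [n_gt0 gl tgt inj] n hu hl hu' hl' ex uniq_n; split=> //=.
- move=> i j [/hu|/hl] [gij|[lt_in ->]]; try by rewrite ltnS n_gt0 ltnW // leqnn.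
    by have [|] := gl i j; [left|lia].
  by have [|] := gl i j; [right|lia].
- move=> j /andP[j_gt0]; rewrite ltnS leq_eqVlt => /orP[/eqP->//|lt_jn].
  have [|i [/hu' ui|/hl' li]] := tgt j; [by rewrite j_gt0 | |].
    by exists i; left.
  by exists i; right.
- move=> i j k ui uj; have [kn|ne_kn] := eqVneq k n; first by move: ui uj; rewrite kn; exact: uniq_n.
  have [ui'|[_ kE]] := hu _ _ ui; last by rewrite kE eqxx in ne_kn.
  have [uj'|[_ kE]] := hu _ _ uj; last by rewrite kE eqxx in ne_kn.
  exact: inj ui' uj'.
Qed.

Lemma well_glued_ge F : well_glued F ->
  forall i, ncells F <= i -> ru F i = None /\ rl F i = None.
Proof.
move=> [_ gl _ _] i le_i; split.
  by case ui: (ru F i) => [j|//]; have [|] := gl i j; [left|lia].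
by case li: (rl F i) => [j|//]; have [|] := gl i j; [right|lia].
Qed.

Lemma fish_well_glued F : is_fish F -> well_glued F.
Proof.
elim=> {F} [|F x _ wF lt_x ux|F x _ wF lt_x lx|F x y z _ wF lt_x ux lx ly uz].
- split=> //; first by move=> i j []. by case=> [|j].
- have [n_gt0 gl tgt inj] := wF; apply: well_glued_step => //.
  + by move=> i j /updP[|[-> ->]]; auto.
  + by move=> i j; auto.
  + by move=> i j; apply: upd_mono.
  + by exists x; left; rewrite upd_same.
  + move=> i j /updP[ui|[-> _]] /updP[uj|[-> _]] //; last by have := gl j (ncells F) (or_introl uj); lia.
      by have := gl i (ncells F) (or_introl ui); lia.
    by have := gl i (ncells F) (or_introl ui); lia.
- have [n_gt0 gl tgt inj] := wF; apply: well_glued_step => //.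
  + by move=> i j; auto.
  + by move=> i j /updP[|[-> ->]]; auto.
  + by move=> i j; apply: upd_mono.
  + by exists x; right; rewrite upd_same.
  + by move=> i j ui; have := gl i (ncells F) (or_introl ui); lia.
- have [n_gt0 gl tgt inj] := wF.
  have lt_y : y < ncells F by have [_ /andP[]] := gl x y (or_introl ux).
  have lt_z : z < ncells F by have [_ /andP[]] := gl x z (or_intror lx).
  apply: well_glued_step => //.
  + by move=> i j /updP[|[-> ->]]; auto.
  + by move=> i j /updP[|[-> ->]]; auto.
  + by move=> i j; apply: upd_mono.
  + by move=> i j; apply: upd_mono.
  + by exists z; left; rewrite upd_same.
  + move=> i j /updP[ui|[-> _]] /updP[uj|[-> _]] //; last by have := gl j (ncells F) (or_introl uj); lia.
      by have := gl i (ncells F) (or_introl ui); lia.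
    by have := gl i (ncells F) (or_introl ui); lia.
Qed.

(** Adds to [rep] what it leaves open: [ru] on the column of the head, and that each cell is listed
    exactly once. *)
Definition represents F T := exists cs s,
  [/\ rep (ru F) (rl F) T (0 :: cs) s, column (ru F) (0 :: cs)
    & perm_eq ((0 :: cs) ++ s) (iota 0 (ncells F))].

Lemma iotaS_rcons m n : iota m n.+1 = rcons (iota m n) (m + n).
Proof. by rewrite -addn1 iotaD cats1. Qed.

Lemma fish_represents F : is_fish F -> exists T, represents F T.
Proof.
have memP n cs s x : perm_eq ((0 :: cs) ++ s) (iota 0 n) -> (x \in (0 :: cs) ++ s) = (x < n).
  by move=> /perm_mem->; rewrite mem_iota.
have new n cs s s' : perm_eq ((0 :: cs) ++ s) (iota 0 n) -> perm_eq s' (n :: s) ->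
    perm_eq ((0 :: cs) ++ s') (iota 0 n.+1).
  move=> p p'; apply: perm_trans (perm_new_catr _ p') _.
  by rewrite iotaS_rcons add0n perm_sym perm_rcons perm_cons perm_sym.
elim=> {F} [|F x fF [T [cs [s [rT col p]]]] lt_x ux|F x fF [T [cs [s [rT col p]]]] lt_x lx
  |F x y z fF [T [cs [s [rT col p]]]] lt_x ux lx ly uz].
- by exists Leaf, [::], [::]; split=> //; exists 0.
- have [un ln] := well_glued_ge (fish_well_glued fF) (leqnn _).
  have xin : x \in (0 :: cs) ++ s by rewrite (memP _ _ _ _ p).
  have nin : ncells F \notin (0 :: cs) ++ s by rewrite (memP _ _ _ _ p) ltnn.
  have us : uniq ((0 :: cs) ++ s) by rewrite (perm_uniq p) iota_uniq.
  have /uniq_catP[ucs us0 disj disj'] := us; have [ncs ns] := notin_cat nin.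
  (* [rep_op1] only covers cells outside the column of the head; if [x] lies in it, it is the top
     and that column itself grows. *)
  case: (boolP (x \in 0 :: cs)) => [xcs|xcs].
    have [cs' csE] := column_top col xcs ux.
    exists (append T), (rcons cs (ncells F)), s; split.
    + apply: (rep_append (cs := 0 :: cs)) => //; apply: rep_eq rT => //; apply: upd_eq; exact: disj.
    + rewrite -rcons_cons csE; apply: column_upd; rewrite -?csE //.
        by move: ucs; rewrite csE rcons_uniq => /andP[].
      by apply: contraNneq ncs => ->.
    + rewrite -rcons_cons cat_rcons; apply: perm_trans (perm_new _ _ _) _.
      by rewrite [X in perm_eq _ X](iotaS_rcons 0 (ncells F)) perm_sym perm_rcons perm_cons perm_sym.
  move: xin; rewrite mem_cat (negPf xcs) /= => xs.
  have [T' [s' [rT' p']]] := rep_op1 un ln rT us0 ns xs ux.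
  exists T', cs, s'; split=> //; last exact: new p p'.
  by apply: column_eq col; apply: upd_eq.
- have [un ln] := well_glued_ge (fish_well_glued fF) (leqnn _).
  have xin : x \in (0 :: cs) ++ s by rewrite (memP _ _ _ _ p).
  have nin : ncells F \notin (0 :: cs) ++ s by rewrite (memP _ _ _ _ p) ltnn.
  have us : uniq ((0 :: cs) ++ s) by rewrite (perm_uniq p) iota_uniq.
  have [T' [s' [rT' p']]] := rep_op2 un ln rT us nin xin lx.
  by exists T', cs, s'; split=> //; exact: new p p'.
- have [un ln] := well_glued_ge (fish_well_glued fF) (leqnn _).
  have xin : x \in (0 :: cs) ++ s by rewrite (memP _ _ _ _ p).
  have nin : ncells F \notin (0 :: cs) ++ s by rewrite (memP _ _ _ _ p) ltnn.
  have us : uniq ((0 :: cs) ++ s) by rewrite (perm_uniq p) iota_uniq.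
  have [T' [s' [rT' p']]] := rep_op3 un ln rT col us nin xin ux lx ly uz.
  exists T', cs, s'; split=> //; last exact: new p p'.
  apply: column_eq col; apply: upd_eq.
  by have /uniq_catP[_ _ _] := us; apply; apply: rep_target rT xin lx.
Qed.

Lemma fish_iso_represents F G T T' : is_fish F -> is_fish G ->
  represents F T -> represents G T' -> fish_iso F G -> T = T'.
Proof.
move=> /fish_well_glued[nF glF _ _] /fish_well_glued[nG glG tgtG _].
move=> [cs [s [rT col p]]] [cs' [s' [rT' col' p']]] [f [g [hf [hg fg]]]].
(* Otherwise [f 0] would be a target in G, and pulling the gluing back would make the head a target
   in F. *)
have f0 : f 0 = 0.
  apply/eqP; case: posnP => // f0_gt0; have [lt_f0 _] := hf _ nF.
  have [|j gj] := tgtG (f 0); first by rewrite f0_gt0.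
  have [lt_j _] := glG _ _ gj; have [lt_gj fgj] := hg _ lt_j.
  have [huj hlj] := fg _ lt_gj; rewrite fgj in huj hlj.
  have [i gi fi] : exists2 i, glued F (g j) i & f i = f 0.
    case: gj => gj.
      by move: huj; rewrite gj; case ui: (ru F (g j)) => [i|] //= [fi]; exists i; [left|].
    by move: hlj; rewrite gj; case li: (rl F (g j)) => [i|] //= [fi]; exists i; [right|].
  have [_ /andP[i_gt0 lt_i]] := glF _ _ gi.
  by have := (hf _ lt_i).2; rewrite fi (hf _ nF).2 => i0; rewrite -i0 in i_gt0.
have memF x : (x \in (0 :: cs) ++ s) = (x < ncells F) by rewrite (perm_mem p) mem_iota.
have rG : rep (ru G) (rl G) T (map f (0 :: cs)) (map f s).
  apply: rep_map rT => x xs; have [|hu hl] // := fg x; first by rewrite -memF.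
  by rewrite -memF mem_cat xs orbT.
have colG : column (ru G) (map f (0 :: cs)).
  by apply: column_map col => x xs; have [|hu hl] // := fg x; rewrite -memF mem_cat xs.
rewrite /= f0 in rG colG; have csE := column_inj colG col'; rewrite csE in rG.
have [] // := rep_inj rG rT'; last by rewrite (perm_uniq p') iota_uniq.
rewrite -csE -{1}f0 -map_cons -map_cat map_inj_in_uniq ?(perm_uniq p) ?iota_uniq // => x x'.
rewrite !memF => lt_x lt_x' fxx'.
by rewrite -(hf _ lt_x).2 fxx' (hf _ lt_x').2.
Qed.

(** The two listings have equal length, and cells in the same position correspond. *)
Lemma represents_iso F G T : represents F T -> represents G T -> fish_iso F G.
Proof.
move=> [cs [s [rT col p]]] [cs' [s' [rT' col' p']]].
set L := (0 :: cs) ++ s in p; set L' := (0 :: cs') ++ s' in p'.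
pose f x := nth 0 L' (index x L); pose g x := nth 0 L (index x L').
have sz : size (0 :: cs) = size (0 :: cs') by rewrite (rep_height rT) (rep_height rT').
have szL : size L = size L' by rewrite !size_cat sz (rep_others rT) (rep_others rT').
have uL : uniq L by rewrite (perm_uniq p) iota_uniq.
have uL' : uniq L' by rewrite (perm_uniq p') iota_uniq.
have memL x : (x \in L) = (x < ncells F) by rewrite (perm_mem p) mem_iota.
have memL' x : (x \in L') = (x < ncells G) by rewrite (perm_mem p') mem_iota.
have mapL : map f L = L'.
  apply: (@eq_from_nth _ 0); rewrite size_map // => i lt_i.
  by rewrite (nth_map 0) // /f index_uniq.
have [csE sE] : map f (0 :: cs) = 0 :: cs' /\ map f s = s'.
  have : map f L == L' by rewrite mapL.
  by rewrite map_cat eqseq_cat ?size_map // => /andP[/eqP-> /eqP->].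
have [hl hu] : {in L, forall x, rl G (f x) = omap f (rl F x)} /\
    {in s, forall x, ru G (f x) = omap f (ru F x)}.
  by apply: rep_morph rT _; rewrite csE sE.
have hu0 : {in 0 :: cs, forall x, ru G (f x) = omap f (ru F x)}.
  by apply: column_morph col _; rewrite csE.
exists f, g; split; [|split] => [i|j|i].
- rewrite -memL -memL' /f /g => iL; have lt_i : index i L < size L' by rewrite -szL index_mem.
  by rewrite mem_nth // index_uniq // nth_index.
- rewrite -memL -memL' /f /g => iL; have lt_i : index j L' < size L by rewrite szL index_mem.
  by rewrite mem_nth // index_uniq // nth_index.
- rewrite -memL => iL; split; last exact: hl.
  by move: iL; rewrite mem_cat => /orP[/hu0|/hu].
Qed.

(** Each count is one more than the exponent. In [Glue] two counts are added, which accounts for the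
    extra one in all three exponents. *)
Lemma rep_counts u l T cs s : rep u l T cs s -> column u cs ->
  [/\ count (fun i => u i == None) (cs ++ s) = (lexp T).+1,
      count (fun i => l i == None) (cs ++ s) = (rexp T).+1
    & count (fun i => (u i == None) && (l i == None)) (cs ++ s) = (texp T).+1].
Proof.
have att D k : (forall cs s, rep u l D cs s -> column u cs ->
  [/\ count (fun i => u i == None) (cs ++ s) = (lexp D).+1,
      count (fun i => l i == None) (cs ++ s) = (rexp D).+1
    & count (fun i => (u i == None) && (l i == None)) (cs ++ s) = (texp D).+1]) ->
  (* Right upper edges are counted on [s] only, since a run may stop below the top of its column. *)
  forall cs s, attached u l (rep u l D) k cs s ->
  [/\ count (fun i => u i == None) s = (lexp D).+1,
      count (fun i => l i == None) (cs ++ s) = (rexp D).+1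
    & count (fun i => (u i == None) && (l i == None)) (cs ++ s) = (texp D).+1].
  move=> IHD {}cs {}s attD; have lcs := attached_some attD.
  move: attD => [ds [s0 [-> rD col _ _]]]; have [hu hl ht] := IHD _ _ rD col.
  rewrite !(count_cat _ cs) hu hl ht; split=> //.
    rewrite (eq_in_count (a2 := pred0)) ?count_pred0 // => x xcs.
    by have [z ->] := lcs x xcs.
  rewrite (eq_in_count (a2 := pred0)) ?count_pred0 // => x xcs.
  by have [z ->] := lcs x xcs; rewrite andbF.
elim: T cs s => [|D IHD k|T IH|D IHD k T IH] cs s /=.
- by move=> [c [-> -> lc]] /= ->; rewrite lc.
- move=> rD col; have [hu -> ->] := att _ _ IHD _ _ rD.
  by rewrite count_cat (count_column col) hu.
- move=> [c [cs' [-> lc rT]]] col; have [uc col'] := column_cons col (rep_neq0 rT).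
  by have [hu hl ht] := IH _ _ rT col'; rewrite /= hu hl ht uc lc.
- move=> [cs1 [cs2 [s1 [s2 [-> -> attD rT]]]]] col.
  have [hu hl ht] := att _ _ IHD _ _ attD.
  have [hu2 hl2 ht2] := IH _ _ rT (column_catr col (rep_neq0 rT)).
  have col0 : count (fun i => u i == None) cs1 = 0.
    apply/eqP; rewrite -leqn0 leqNgt -has_count; apply/hasPn => x xcs.
    by have [z ->] := column_catl col (rep_neq0 rT) xcs.
  move: hu hl ht hu2 hl2 ht2; rewrite !count_cat.
  move=> hu hl ht hu2 hl2 ht2; split; rewrite addnACA.
  - by rewrite col0 add0n hu hu2 addSn addnS.
  - by rewrite hl hl2 addSn addnS.
  - by rewrite ht ht2 addSn addnS.
Qed.

(** An injective partial map has as many targets as sources; hence there are as many free left lower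
    as free right upper edges. *)
Lemma count_nontargets (u : nat -> option nat) n :
    (forall i j, i < n -> u i = Some j -> j < n) ->
    (forall i j k, u i = Some k -> u j = Some k -> i = j) ->
  count (fun i => ~~ has (fun j => u j == Some i) (iota 0 n)) (iota 0 n) =
  count (fun i => u i == None) (iota 0 n).
Proof.
move=> bnd inj; set c := iota 0 n.
have inj_pmap : uniq (pmap u c).
  rewrite /c; elim: (iota 0 n) (iota_uniq 0 n) => //= i s IH /andP[is_ us].
  case ui: (u i) => [k|] /=; last exact: IH.
  rewrite IH // andbT mem_pmap; apply: contra is_ => /mapP[j js].
  by rewrite -ui => uij; move: (uij); rewrite ui => /esym uj; rewrite (inj _ _ _ ui uj).
have tgt : count (fun i => has (fun j => u j == Some i) c) c = count (fun i => u i != None) c.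
  transitivity (size (pmap u c)); last by rewrite size_pmap; apply: eq_count => i; case: (u i).
  rewrite -size_filter; apply/perm_size/uniq_perm; rewrite ?filter_uniq ?iota_uniq // => i.
  rewrite mem_filter mem_pmap; apply/andP/mapP => [[/hasP[j jc /eqP uj] _]|[j jc uj]].
    by exists j.
  split; first by apply/hasP; exists j; rewrite // -uj.
  by move: jc; rewrite !mem_iota => jn; apply: bnd (esym uj).
have h1 := count_predC (fun i => has (fun j => u j == Some i) c) c.
have h2 := count_predC (fun i => u i != None) c.
have h3 : count (predC (fun i => u i != None)) c = count (fun i => u i == None) c.
  by apply: eq_count => i /=; rewrite negbK.
apply: (@addnI (count (fun i => has (fun j => u j == Some i) c) c)).
by rewrite {2}tgt -h3 h2; exact: h1.
Qed.

Lemma represents_stats F T : is_fish F -> represents F T ->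
  [/\ fsize F = (tree_order T).+1, Defs.tails F = (texp T).+1,
      rsize F = (rexp T).+1 & lsize F = (lexp T).+1].
Proof.
move=> /fish_well_glued[n_gt0 gl _ inj] [cs [s [rT col /permP p]]].
have [hu hl ht] := rep_counts rT col; rewrite !p in hu hl ht.
have lE : lsize F = (lexp T).+1.
  rewrite /lsize count_nontargets // => i j _ ui.
  by have [_ /andP[]] := gl i j (or_introl ui).
split=> //; rewrite /fsize lE [rsize F]hl /tree_order; lia.
Qed.

End Fish.

(** * From trees to fish *)

Section Construction.
Implicit Types (F G : prefish) (T D : ftree) (cs ds s : seq nat).

(* [F'] is obtained from [F] by adding cells, the only old edges that got glued
   being right lower edges of cells in [cs]. *)
Definition extends cs F F' :=
  [/\ is_fish F', ncells F <= ncells F',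
      forall i, i < ncells F -> ru F' i = ru F i
    & forall i, i < ncells F -> i \notin cs -> rl F' i = rl F i].

(** A run of consecutive cells of a column on which children can still be hung. It uses [sorted] and
    not [column] because it may stop below the top. *)
Definition bare F cs := [/\ all (fun i => i < ncells F) cs, uniq cs,
  sorted (fun c d => ru F c == Some d) cs & {in cs, forall c, rl F c = None}].

Lemma fish_op1_ncells F : is_fish F -> ru F (ncells F) = None /\ rl F (ncells F) = None.
Proof. by move=> /fish_well_glued/well_glued_ge; apply. Qed.

Lemma heighten F m p h : is_fish F -> ncells F = m + p.+1 -> column (ru F) (iota m p.+1) ->
    (forall i, m <= i -> rl F i = None) ->
  exists F', [/\ is_fish F', ncells F' = m + p.+1 + h, column (ru F') (iota m (p.+1 + h)),
    forall i, i < m -> ru F' i = ru F i & rl F' =1 rl F].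
Proof.
move=> fF nF col lF; elim: h => [|h [F' [fF' nF' col' uF' lF']]].
  by exists F; rewrite !addn0.
have [un ln] := fish_op1_ncells fF'.
have nE : ncells F' = (m + (p + h)).+1 by lia.
rewrite addSn iotaS_rcons in col'; rewrite nE in un.
have top_lt : m + (p + h) < ncells F' by rewrite nE.
have := fish_op1 fF' top_lt (column_last col'); rewrite nE => fF2.
eexists; split; first exact: fF2.
- by rewrite /=; lia.
- have -> : p.+1 + h.+1 = (p + h).+2 by lia.
  rewrite !iotaS_rcons addnS; apply: column_upd => //; last by lia.
  by rewrite mem_iota; lia.
- by move=> i lt_i; rewrite /= updE ?uF' //; apply/eqP; lia.
- exact: lF'.
Qed.

(** Operation (ii) on the lowest cell of the run, then (iii) on each next one; the new cells get
    consecutive numbers. *)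
Lemma glue_column F cs : is_fish F -> bare F cs -> cs <> [::] -> exists F',
  [/\ extends cs F F', ncells F' = ncells F + size cs,
      column (ru F') (iota (ncells F) (size cs)),
      map (rl F') cs = map Some (iota (ncells F) (size cs))
    & forall i, ncells F <= i -> rl F' i = None].
Proof.
move=> fF; elim/last_ind: cs => // e x IH [lt_cs uniq_cs sorted_cs lcs] _.
have lx : rl F x = None by apply: lcs; rewrite mem_rcons mem_head.
have lt_x : x < ncells F by apply: (allP lt_cs); rewrite mem_rcons mem_head.
have xe : x \notin e by move: uniq_cs; rewrite rcons_uniq => /andP[].
have geF := well_glued_ge (fish_well_glued fF).
case/lastP: e IH lt_cs uniq_cs sorted_cs lcs xe => [|e w] IH lt_cs uniq_cs sorted_cs lcs xe.
  have := fish_op2 fF lt_x lx; set F' := PreFish _ _ _ => fF'.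
  exists F'; split=> //=.
  - split=> //= i lt_i; rewrite mem_seq1 => ix; exact: updE.
  - by rewrite addn1.
  - by have [] := geF _ (leqnn _).
  - by rewrite upd_same.
  - by move=> i le_i; rewrite updE; [have [] := geF _ le_i | apply/eqP; lia].
have bare_e : bare F (rcons e w).
  split.
  - by move: lt_cs; rewrite all_rcons => /andP[].
  - by move: uniq_cs; rewrite rcons_uniq => /andP[].
  - by move: sorted_cs; rewrite -cats1 => /cat_sorted2[].
  - by move=> c ce; apply: lcs; rewrite mem_rcons in_cons ce orbT.
have [|F1 [[fF1 le_n uF1 lF1] nF1 colF1 mapF1 geF1]] := IH bare_e; first by case: (e).
have wux : ru F w = Some x.
  move: sorted_cs; rewrite -!cats1 -catA => /cat_sorted2[_] /=.
  by rewrite andbT => /eqP.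
have lt_w : w < ncells F by apply: (allP lt_cs); rewrite mem_rcons in_cons mem_rcons mem_head orbT.
set n := ncells F in nF1 colF1 mapF1 geF1 le_n uF1 lF1 geF lt_x lt_w *.
have lw1 : rl F1 w = Some (n + size e).
  move: mapF1; rewrite size_rcons iotaS_rcons !map_rcons.
  by move=> /rcons_inj[].
have uw1 : ru F1 w = Some x by rewrite uF1.
have lx1 : rl F1 x = None by rewrite lF1.
have uz1 : ru F1 (n + size e) = None.
  by move: colF1; rewrite size_rcons iotaS_rcons; apply: column_last.
(* [w] is the cell below [x] in the run and [n + size e] the current top of the new column. *)
have := @fish_op3 F1 w x (n + size e) fF1 _ uw1 lw1 lx1 uz1.
have [un1 _] := fish_op1_ncells fF1.
set F2 := PreFish _ _ _ => fF2; exists F2; split=> //=.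
- split=> //=.
  + by apply: fF2; apply: leq_trans le_n.
  + by lia.
  + by move=> i lt_i; rewrite updE ?uF1 //; apply/eqP; lia.
  + move=> i lt_i; rewrite mem_rcons in_cons negb_or => /andP[ix ie].
    by rewrite updE // lF1.
- by rewrite nF1 !size_rcons !addnS.
- rewrite nF1 !size_rcons !iotaS_rcons addnS; apply: column_upd.
  + by move: colF1; rewrite size_rcons iotaS_rcons.
  + by rewrite nF1 size_rcons addnS in un1.
  + by rewrite mem_iota; lia.
  + by lia.
- rewrite [in RHS]size_rcons [in RHS]iotaS_rcons [in RHS]map_rcons -mapF1 map_rcons upd_same nF1.
  by congr rcons; apply/esym/eq_in_map; apply: upd_eq.
- by move=> i le_i; rewrite updE ?geF1 //; apply/eqP; lia.
Qed.

Lemma column_sorted u cs : column u cs -> sorted (fun c d => u c == Some d) cs.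
Proof.
elim: cs => //= c [|d cs] IH //= [-> col]; rewrite eqxx; exact: IH.
Qed.

(** The k glued cells of the child are created together with the run, operation (i) raises the child
    to its full height, and its own children are then hung on the completed, still bare column. *)
Lemma build_attached D k :
    (forall F ds, is_fish F -> bare F ds -> size ds = height D -> exists F' s,
       [/\ extends ds F F', rep (ru F') (rl F') D ds s
         & s = iota (ncells F) (ncells F' - ncells F)]) -> 0 < k <= height D ->
  forall F cs, is_fish F -> bare F cs -> size cs = k -> exists F' s,
    [/\ extends cs F F', attached (ru F') (rl F') (rep (ru F') (rl F') D) k cs s
         & s = iota (ncells F) (ncells F' - ncells F)].
Proof.
move=> build /andP[k_gt0 le_k] F cs fF bare_cs size_cs.
have cs_neq0 : cs <> [::] by move=> cs0; rewrite -size_cs cs0 in k_gt0.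
have [F1 [[fF1 le1 uF1 lF1] nF1 col1 map1 ge1]] := glue_column fF bare_cs cs_neq0.
have [lt_cs uniq_cs _ _] := bare_cs.
set n := ncells F in nF1 col1 map1 ge1 le1 uF1 lF1 lt_cs *.
rewrite size_cs -(prednK k_gt0) in nF1 col1.
have [F2 [fF2 nF2 col2 uF2 lF2]] := heighten (height D - k) fF1 nF1 col1 ge1.
rewrite prednK // subnKC // in col2; rewrite prednK // -addnA subnKC // in nF2.
set ds := iota n (height D) in col2.
have bare_ds : bare F2 ds.
  split.
  - by apply/allP => i; rewrite mem_iota nF2 => /andP[].
  - exact: iota_uniq.
  - exact: column_sorted.
  - by move=> i; rewrite mem_iota lF2 => /andP[/ge1].
have [F3 [s0 [[fF3 le3 uF3 lF3] rD s0E]]] := build F2 ds fF2 bare_ds (size_iota _ _).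
exists F3, (ds ++ s0); split.
- split=> //; first by lia.
  + by move=> i lt_i; rewrite uF3 ?uF2 ?uF1 //; lia.
  + move=> i lt_i ics; rewrite lF3 ?lF2 ?lF1 //; first by lia.
    by rewrite mem_iota; lia.
- exists ds, s0; split=> //; last by rewrite size_iota k_gt0.
    by apply: column_eq col2 => i; rewrite mem_iota => /andP[_ lt_i]; rewrite uF3 // nF2.
  transitivity (map (rl F1) cs).
    apply/eq_in_map => c cin; have lt_c := allP lt_cs _ cin.
    by rewrite lF3 ?lF2 //; [lia | rewrite mem_iota; lia].
  by rewrite map1 size_cs take_iota (minn_idPl le_k).
- by rewrite s0E nF2 -iotaD; congr iota; lia.
Qed.

(** Requiring the listing [s] to be the interval of newly created numbers makes disjointness and
    exhaustiveness immediate. *)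
Lemma build_tree T F cs : valid T -> is_fish F -> bare F cs -> size cs = height T ->
  exists F' s, [/\ extends cs F F', rep (ru F') (rl F') T cs s
    & s = iota (ncells F) (ncells F' - ncells F)].
Proof.
elim: T F cs => [|D IHD k|T IH|D IHD k T IH] F cs /=.
- move=> _ fF [_ _ _ lcs]; case: cs lcs => [|c [|d cs]] // lcs _.
  exists F, [::]; split=> //; last by rewrite subnn.
  by exists c; split=> //; apply: lcs; rewrite mem_head.
- move=> /andP[vD le_k] fF bare_cs size_cs.
  by apply: build_attached le_k _ _ fF bare_cs size_cs => G ds *; apply: IHD.
- move=> vT fF bare_cs; case: cs bare_cs => // c cs [/= /andP[lt_c lt_cs] /andP[c_cs ucs] srt lcs] [size_cs].
  have bare_cs : bare F cs.
    split=> //; first exact: path_sorted srt.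
    by move=> i ics; apply: lcs; rewrite in_cons ics orbT.
  have [F' [s [[fF' le' uF' lF'] rT sE]]] := IH _ _ vT fF bare_cs size_cs.
  exists F', s; split=> //.
    by split=> // i lt_i; rewrite in_cons negb_or => /andP[_]; apply: lF'.
  exists c, cs; split=> //; rewrite lF' //; apply: lcs; exact: mem_head.
- move=> /and3P[vD le_k vT] fF [lt_cs ucs srt lcs] size_cs.
  set cs1 := take k cs; set cs2 := drop k cs.
  have csE : cs = cs1 ++ cs2 by rewrite cat_take_drop.
  have size1 : size cs1 = k by rewrite size_takel // size_cs leq_addr.
  have size2 : size cs2 = height T by rewrite size_drop size_cs addKn.
  rewrite csE all_cat in lt_cs; have /andP[lt1 lt2] := lt_cs.
  rewrite csE in ucs; have /uniq_catP[u1 u2 disj disj'] := ucs.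
  rewrite csE in srt; have [srt1 srt2] := cat_sorted2 srt.
  have bare1 : bare F cs1.
    by split=> // c c1; apply: lcs; rewrite csE mem_cat c1.
  have [G ds *|F1 [s1 [[fF1 le1 uF1 lF1] att1 s1E]]] :=
    @build_attached D k _ le_k F cs1 fF bare1 size1; first exact: IHD.
  (* Among old edges, building the first child only glued right lower edges of [cs1]. *)
  have bare2 : bare F1 cs2.
    split=> //.
    - by apply/allP => c /(allP lt2) lt_c; apply: leq_trans le1.
    - move: srt2 (lt2); case: (cs2) => //= c r; elim: r c => //= d r IHr c.
      move=> /andP[uc pr] /and3P[lt_c lt_d lt_r]; rewrite uF1 // uc /=.
      by apply: IHr; rewrite ?lt_d.
    - move=> c c2; rewrite lF1 ?disj' // ?(allP lt2) //.
      by apply: lcs; rewrite csE mem_cat c2 orbT.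
  have [F2 [s2 [[fF2 le2 uF2 lF2] rT s2E]]] := IH _ _ vT fF1 bare2 size2.
  have lt_s1 i : i \in s1 -> i < ncells F1.
    by rewrite s1E mem_iota subnKC // => /andP[].
  exists F2, (s1 ++ s2); split.
  + split=> //; first exact: leq_trans le2.
      by move=> i lt_i; rewrite uF2 ?uF1 //; apply: leq_trans le1.
    move=> i lt_i; rewrite csE mem_cat negb_or => /andP[i1 i2].
    by rewrite lF2 ?lF1 //; apply: leq_trans le1.
  + exists cs1, cs2, s1, s2; split=> //.
    apply: (rep_eq (T := Cap D k)) att1 => i.
      rewrite mem_cat => /orP[i1|i1].
        by rewrite lF2 ?disj //; apply: leq_trans le1; apply: (allP lt1).
      rewrite lF2 ?lt_s1 //; apply/negP => /(allP lt2).
      by move: i1; rewrite s1E mem_iota; lia.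
    by move=> /lt_s1 lt_i; rewrite uF2.
  + rewrite s1E s2E -[X in _ ++ iota X _](subnKC le1) -iotaD; congr iota.
    by move: le1 le2; lia.
Qed.

Lemma fish_of_tree T : valid T -> exists2 F, is_fish F & represents F T.
Proof.
move=> vT.
have h_gt0 : 0 < height T.
  elim: T vT => //= [D _ k /andP[_ /andP[]]|D _ k T _ /and3P[_ /andP[k_gt0 _] _]] //.
  by rewrite addn_gt0 k_gt0.
have [F [fF nF col _ lF]] := @heighten head_fish 0 0 (height T).-1 fish_head erefl erefl (fun _ _ => erefl).
rewrite !add0n add1n prednK // in nF col.
have bareF : bare F (iota 0 (height T)).
  split.
  - by apply/allP => i; rewrite mem_iota nF.
  - exact: iota_uniq.
  - exact: column_sorted.
  - by move=> i _; rewrite lF.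
have [F' [s [[fF' le' uF' lF'] rT sE]]] := build_tree vT fF bareF (size_iota _ _).
exists F' => //; exists (iota 1 (height T).-1), s.
have <- : iota 0 (height T) = 0 :: iota 1 (height T).-1 by rewrite -{1}(prednK h_gt0).
split=> //.
  by apply: column_eq col => i; rewrite mem_iota => lt_i; rewrite uF' ?nF.
by rewrite sE nF -(iotaD 0 (height T)) subnKC -?nF.
Qed.

End Construction.

(** * Counting fish *)

Section Coefficients.
Local Open Scope ring_scope.

Lemma coefs_varXM_const (K : comNzRingType) (c : K) i n :
  (svar K ^+ i * sconst c) n = if i == n then c else 0.
Proof.
by rewrite coefs_varXM /sconst subn_eq0; case: ltngtP.
Qed.

Lemma coef_weight T k r m : weight var_y var_a var_b T k r m =
  if [&& texp T == k, rexp T == r & lexp T == m] then 1 else 0.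
Proof.
pose v := svar rat ^+ lexp T.
pose w := svar (series rat) ^+ rexp T * sconst v.
have -> : weight var_y var_a var_b T = svar (series (series rat)) ^+ texp T * sconst w.
  rewrite /w (rmorphM (@sconst (series (series rat)))) mulrA.
  rewrite (rmorphXn (@sconst (series (series rat)))) /v.
  rewrite (rmorphXn (@sconst (series rat))) (rmorphXn (@sconst (series (series rat)))).
  by [].
rewrite coefs_varXM_const; case: eqP => _ /=; last by rewrite !coefs0.
rewrite /w coefs_varXM_const; case: eqP => _ /=; last by rewrite coefs0.
by rewrite /v -[svar rat ^+ _]mulr1 coefs_varXM_const.
Qed.

Lemma coef_total n k r m : total_series var_y var_a var_b n k r m =
  (size [seq T <- trees n | [&& tree_order T == n, texp T == k, rexp T == r & lexp T == m]])%:R.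
Proof.
rewrite /total_series !coefs_sum size_filter -sum1_count natr_sum big_mkcond.
rewrite [RHS]big_mkcond; apply: eq_bigr => T _.
by case: (tree_order T == n) => //=; rewrite coef_weight.
Qed.

End Coefficients.

(** [fish_of_tree] is a mere existence statement; the representatives are chosen by induction on the
    list. *)
Lemma fish_of_trees (Ts : seq ftree) : {in Ts, forall T, valid T} ->
  exists2 L, size L = size Ts & forall i, i < size Ts ->
    is_fish (nth head_fish L i) /\ represents (nth head_fish L i) (nth Leaf Ts i).
Proof.
elim: Ts => [|T Ts IH] vTs; first by exists [::].
have [|L szL LP] := IH; first by move=> T' T'in; apply: vTs; rewrite in_cons T'in orbT.
have [F fF FT] := fish_of_tree (vTs T (mem_head _ _)).
by exists (F :: L) => [|[|i]] //=; [rewrite szL | move=> lt_i; apply: LP].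
Qed.

(* B is the unique series solving the equation, and for all exponents the
   coefficient of t^n y^k a^r b^l in P(t,y,a,b;1) (the number of fish of size
   n+1 with k+1 tails, right size r+1, left size l+1) equals the corresponding
   coefficient of the claimed expression in B. *)
Theorem theorem7 :
  exists B : fps,
    B_equation B /\ (forall B' : fps, B_equation B' -> B' = B) /\
    (forall n k r l : nat, exists m : nat,
       fish_number_is (fun F => [/\ fsize F = n.+1, tails F = k.+1,
                                    rsize F = r.+1 & lsize F = l.+1]) m /\
       P_formula B n k r l = (m%:R)%R).
Proof.
have [B eqB PB] := total_series_formula; exists B; split=> //; split.
  by move=> B'; apply: B_equation_unique.
(* [Ts] has one tree for each isomorphism class of fish with the prescribed statistics; size n+1
   means tree order n. *)
move=> n k r l; rewrite PB coef_total; set Ts := filter _ _; exists (size Ts); split=> //.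
have TsP T : T \in Ts <->
    valid T /\ [/\ tree_order T = n, texp T = k, rexp T = r & lexp T = l].
  rewrite mem_filter mem_trees; split=> [/andP[/and4P[/eqP? /eqP? /eqP? /eqP?] /andP[]]//|].
  move=> [vT [eq_n -> -> ->]]; rewrite eq_n !eqxx vT -eq_n; exact: depth_tree_order.
have [|L szL LP] := @fish_of_trees Ts; first by move=> T /TsP[].
exists L; split=> //; split; [|split].
- move=> i lt_i; have [fF FT] := LP i lt_i; split=> //.
  have /TsP[_ [<- <- <- <-]] := mem_nth Leaf lt_i.
  exact: represents_stats.
- move=> i j lt_i lt_j iso; have [fi ri] := LP i lt_i; have [fj rj] := LP j lt_j.
  apply/eqP; rewrite -(nth_uniq Leaf lt_i lt_j) ?filter_uniq ?uniq_trees //; apply/eqP.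
  exact: fish_iso_represents fi fj ri rj iso.
- move=> F fF; have [T FT] := fish_represents fF; have [-> -> -> ->] := represents_stats fF FT.
  move=> [[ord] [te] [re] [le]]; have vT : valid T by have [cs [s [/rep_valid]]] := FT.
  have Tin : T \in Ts by apply/TsP.
  have lt_i : index T Ts < size Ts by rewrite index_mem.
  exists (index T Ts) => //; have [fL rL] := LP _ lt_i; rewrite nth_index // in rL.
  exact: represents_iso FT rL.
Qed.
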